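(* Let $g \colon \mathbb{R} \longrightarrow\mathbb{R}$ be a smooth function with $g''(t) > 0$ for all $t\in\mathbb{R}$ and $g'(\infty) - g'(-\infty) = \frac{\pi}{10}$. Let $f\colon \mathbb{R}^2 \longrightarrow\mathbb{R}$ be defined by $f(x,y) = g(x) - g(y)$, and let $\widetilde{M}\subset\mathbb{R}^3$ be the graph of $f$. Then $\widetilde{M}$ with the Riemannian metric induced from $\mathbb{R}^3$ is a negatively curved manifold that is not a visibility manifold.
   Context: $g'(\pm\infty)$ denotes $\lim_{t\to\pm\infty}g'(t)$. $\mathbb{R}^3$ carries the Euclidean metric. Negatively curved means that the (sectional, here Gaussian) curvature is $<0$ everywhere. A simply connected, complete, nonpositively curved manifold $Z$ is a visibility manifold (satisfies the visibility axiom) if any two distinct points of its boundary at infinity $\partial_\infty Z$ (equivalence classes of asymptotic geodesic rays) can be connected by a geodesic of $Z$, i.e. are the two endpoints at infinity of a complete geodesic line in $Z$. *)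

(* Defs.v *)
From Stdlib Require Import Reals.
From Coquelicot Require Import Coquelicot.
Open Scope R_scope.

(** A [metric] below stands for a Riemannian manifold whose underlying smooth
    manifold is the plane [R * R], described in its global coordinate system;
    such a manifold is simply connected. *)

Inductive idx : Set := I1 | I2.

Definition coord {T : Type} (i : idx) (p : T * T) : T :=
  match i with I1 => fst p | I2 => snd p end.

Definition sum_idx (a : idx -> R) : R := a I1 + a I2.

Definition partial_along (i : idx) (u : R * R -> R) (p : R * R) : R -> R :=
  match i with
  | I1 => fun s => u (s, snd p)
  | I2 => fun s => u (fst p, s)
  end.

Definition partial (i : idx) (u : R * R -> R) (p : R * R) : R :=
  Derive (partial_along i u p) (coord i p).

Fixpoint Ck (n : nat) (u : R * R -> R) : Prop :=
  match n with
  | O => forall p : R * R, continuous u p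
  | S m =>
      (forall p : R * R, continuous u p) /\
      forall i : idx,
        (forall p : R * R, ex_derive (partial_along i u p) (coord i p)) /\
        Ck m (partial i u)
  end.

Definition smooth_plane (u : R * R -> R) : Prop := forall n : nat, Ck n u.

Definition smooth_line (g : R -> R) : Prop :=
  forall (n : nat) (t : R), ex_derive_n g n t.

Definition metric : Type := idx -> idx -> R * R -> R.

Definition inner (h : metric) (p v w : R * R) : R :=
  sum_idx (fun i => sum_idx (fun j => h i j p * coord i v * coord j w)).

Definition riemannian_metric (h : metric) : Prop :=
  (forall i j, smooth_plane (h i j)) /\
  (forall i j p, h i j p = h j i p) /\
  (forall p v : R * R, v <> (0, 0) -> 0 < inner h p v v).

Definition metric_det (h : metric) (p : R * R) : R :=
  h I1 I1 p * h I2 I2 p - h I1 I2 p * h I2 I1 p.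

Definition metric_inv (h : metric) : metric := fun i j p =>
  match i, j with
  | I1, I1 => h I2 I2 p / metric_det h p
  | I2, I2 => h I1 I1 p / metric_det h p
  | I1, I2 => - h I1 I2 p / metric_det h p
  | I2, I1 => - h I2 I1 p / metric_det h p
  end.

(** [christoffel h k i j] is Gamma^k_{ij} of the Levi-Civita connection. *)
Definition christoffel (h : metric) (k i j : idx) (p : R * R) : R :=
  / 2 * sum_idx (fun l => metric_inv h k l p *
     (partial i (h j l) p + partial j (h i l) p - partial l (h i j) p)).

(** The coefficient of d_l in R(d_i, d_j) d_k, with the convention
    R(X, Y) Z = D_X D_Y Z - D_Y D_X Z - D_[X,Y] Z. *)
Definition riemann (h : metric) (i j k l : idx) (p : R * R) : R :=
  partial i (christoffel h l j k) p - partial j (christoffel h l i k) p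
  + sum_idx (fun m => christoffel h m j k p * christoffel h l i m p
                      - christoffel h m i k p * christoffel h l j m p).

(** Sectional curvature of the tangent plane at [p]:
    <R(d_1, d_2) d_2, d_1> / (|d_1|^2 |d_2|^2 - <d_1, d_2>^2). *)
Definition curvature (h : metric) (p : R * R) : R :=
  sum_idx (fun l => riemann h I1 I2 I2 l p * h l I1 p) / metric_det h p.

Definition negatively_curved (h : metric) : Prop :=
  forall p : R * R, curvature h p < 0.

Definition speed (h : metric) (c v : R -> R * R) (t : R) : R :=
  sqrt (inner h (c t) (v t) (v t)).

(** [c] is C^1 on [[0, 1]] with velocity [v].  Asking for two-sided derivatives
    at the end points is harmless: [c] and [v] are total functions whose values
    outside [[0, 1]] are irrelevant, and a C^1 curve on [[0, 1]] extends. *)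
Definition C1_curve (c v : R -> R * R) : Prop :=
  forall t : R, 0 <= t <= 1 -> forall i : idx,
    is_derive (fun s => coord i (c s)) t (coord i (v t)) /\
    continuous (fun s => coord i (v s)) t.

(** [path_length h p q l]: some piecewise C^1 path, that is, some finite
    concatenation of C^1 curves, leads from [p] to [q] and has length [l]. *)
Inductive path_length (h : metric) : R * R -> R * R -> R -> Prop :=
| path_nil : forall p : R * R, path_length h p p 0
| path_cons : forall (c v : R -> R * R) (q : R * R) (l : R),
    C1_curve c v ->
    path_length h (c 1) q l ->
    path_length h (c 0) q (RInt (speed h c v) 0 1 + l).

Definition riem_dist (h : metric) (p q : R * R) : R :=
  real (Glb_Rbar (path_length h p q)).

Definition complete (h : metric) : Prop :=
  forall u : nat -> R * R,
    (forall eps : R, 0 < eps -> exists N : nat, forall m n : nat,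
       (N <= m)%nat -> (N <= n)%nat -> riem_dist h (u m) (u n) < eps) ->
    exists p : R * R, is_lim_seq (fun n => riem_dist h (u n) p) 0.

(** [c] restricted to [D] is a unit speed geodesic with velocity [v].  For
    [D = [0, oo)] the two-sided derivatives at [0] are again harmless, the
    values of [c] and [v] outside [D] being unconstrained. *)
Definition unit_geodesic (h : metric) (D : R -> Prop) (c : R -> R * R) : Prop :=
  exists v : R -> R * R, forall t : R, D t ->
    inner h (c t) (v t) (v t) = 1 /\
    forall k : idx,
      is_derive (fun s => coord k (c s)) t (coord k (v t)) /\
      is_derive (fun s => coord k (v s)) t
        (- sum_idx (fun i => sum_idx (fun j =>
             christoffel h k i j (c t) * coord i (v t) * coord j (v t)))).

Definition geodesic_ray (h : metric) (c : R -> R * R) : Prop :=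
  unit_geodesic h (fun t => 0 <= t) c.

Definition geodesic_line (h : metric) (c : R -> R * R) : Prop :=
  unit_geodesic h (fun _ => True) c.

Definition asymptotic (h : metric) (c1 c2 : R -> R * R) : Prop :=
  exists B : R, forall t : R, 0 <= t -> riem_dist h (c1 t) (c2 t) <= B.

(** A point at infinity is an equivalence class of asymptotic geodesic rays. *)
Definition boundary_point (h : metric) (xi : (R -> R * R) -> Prop) : Prop :=
  exists r : R -> R * R, geodesic_ray h r /\
    forall s : R -> R * R, xi s <-> geodesic_ray h s /\ asymptotic h r s.

Definition visibility_axiom (h : metric) : Prop :=
  forall xi eta : (R -> R * R) -> Prop,
    boundary_point h xi -> boundary_point h eta -> xi <> eta ->
    exists c : R -> R * R,
      geodesic_line h c /\ xi (fun t => c (- t)) /\ eta c.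

(** Global parametrisation of the graph of [f]. *)
Definition graph_param (f : R * R -> R) (p : R * R) : R * R * R :=
  (fst p, snd p, f p).

(** First fundamental form of a parametrised surface in Euclidean R^3, i.e. the
    metric induced on its image, read in the coordinates of the parametrisation. *)
Definition induced_metric (F : R * R -> R * R * R) : metric := fun i j p =>
    partial i (fun q => fst (fst (F q))) p * partial j (fun q => fst (fst (F q))) p
  + partial i (fun q => snd (fst (F q))) p * partial j (fun q => snd (fst (F q))) p
  + partial i (fun q => snd (F q)) p * partial j (fun q => snd (F q)) p.

(* Main.v *)
Require Import Defs.
From Stdlib Require Import Reals Lra Lia Psatz Classical FunctionalExtensionality.
From Coquelicot Require Import Coquelicot.
Open Scope R_scope.

(** Write [p = g'], [k = g''] and [W = 1 + p(x)^2 + p(y)^2].  The graph is a translation surface,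
    and its geodesics are the curves whose acceleration in space is normal to it:
    [x'' = - p(x) Q / W] and [y'' = p(y) Q / W], where [Q = k(x) x'^2 - k(y) y'^2].  The curvature
    is [- k(x) k(y) / W^2], which is negative.  Lengths are at least Euclidean, and since [p] is
    bounded they are at most a multiple of Euclidean ones; this gives completeness.

    Visibility fails because geodesics are almost straight in space.  Along a geodesic the
    functions [g(x)] and [g(y)] are convex ([climb_x_convex], [climb_y_convex]), so each of them
    turns at most once, and the total variation of [p(x)], like that of [p(y)], is at most
    [2 (b - a)] ([slope_variation]).  These variations bound the curvature of the geodesic in
    space, so its unit tangent [T] moves by at most [4 (b - a) = 2 pi / 5 < sqrt 2]
    ([tangent_turning]).  Hence the inner product of any two tangents of a geodesic is at least a
    constant [delta > 0] ([tangent_dot]), and the same follows for chords ([chord_chord]).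

    The diagonal [x = y], of height [0], is a straight line in space, hence a geodesic; it
    provides two rays.  A third ray starts from the origin orthogonally to the diagonal.  As it
    advances at rate at least [delta] in its initial direction, it is asymptotic to neither half
    of the diagonal ([transversal_not_diagonal]).  Under visibility a line would join either end
    of the diagonal to the end of that third ray.  The past of such a line runs along the diagonal,
    so its future recedes from this end of the diagonal at a linear rate
    ([line_from_diagonal_end]).  The third ray would thus recede linearly from both ends of the
    diagonal, that is, its coordinate [x + y] would tend to both infinities: a contradiction.

    The third ray is a global solution of the geodesic equation.  It is constructed by Picard
    iteration ([global_solution]) for a system with truncated velocities, which agrees with the
    geodesic equation as long as both components of the velocity are at most one in absolute
    value, and which still preserves the energy ([unit_geodesic_exists]). *)

(** * Calculus on intervals *)

Lemma is_derive_continuous (f : R -> R) (t l : R) : is_derive f t l -> continuous f t.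
Proof. intros H. apply (ex_derive_continuous f t). now exists l. Qed.

Lemma continuous_continuity_pt (f : R -> R) (t : R) : continuous f t -> continuity_pt f t.
Proof. intros H. now apply continuity_pt_filterlim. Qed.

Lemma is_derive_eq (f : R -> R) (t l l' : R) : is_derive f t l -> l = l' -> is_derive f t l'.
Proof. now intros H <-. Qed.

Lemma is_derive_Rmult (f g : R -> R) (t df dg : R) :
  is_derive f t df -> is_derive g t dg ->
  is_derive (fun s => f s * g s) t (df * g t + f t * dg).
Proof. intros Hf Hg. apply (is_derive_mult f g); try assumption. intros; apply Rmult_comm. Qed.

Lemma is_derive_Rcomp (f g : R -> R) (t df dg : R) :
  is_derive f (g t) df -> is_derive g t dg -> is_derive (fun s => f (g s)) t (df * dg).
Proof.
  intros Hf Hg. eapply is_derive_eq.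
  - apply (is_derive_comp f g); eassumption.
  - unfold scal; simpl; unfold mult; simpl. ring.
Qed.

Lemma is_derive_Rplus (f g : R -> R) (t df dg : R) :
  is_derive f t df -> is_derive g t dg -> is_derive (fun s => f s + g s) t (df + dg).
Proof. exact (is_derive_plus f g t df dg). Qed.

Lemma is_derive_Rminus (f g : R -> R) (t df dg : R) :
  is_derive f t df -> is_derive g t dg -> is_derive (fun s => f s - g s) t (df - dg).
Proof. exact (is_derive_minus f g t df dg). Qed.

Lemma is_derive_Rscal (f : R -> R) (c t df : R) :
  is_derive f t df -> is_derive (fun s => c * f s) t (c * df).
Proof. exact (is_derive_scal f t c df). Qed.

Lemma Rmax_contraction (c r s : R) : Rabs (Rmax c r - Rmax c s) <= Rabs (r - s).
Proof.
  unfold Rmax; destruct (Rle_dec c r), (Rle_dec c s); unfold Rabs; repeat destruct Rcase_abs; lra.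
Qed.

Lemma Rmin_contraction (c r s : R) : Rabs (Rmin c r - Rmin c s) <= Rabs (r - s).
Proof.
  unfold Rmin; destruct (Rle_dec c r), (Rle_dec c s); unfold Rabs; repeat destruct Rcase_abs; lra.
Qed.

Lemma lipschitz_continuous (f : R -> R) :
  (forall r s, Rabs (f r - f s) <= Rabs (r - s)) -> forall t, continuous f t.
Proof.
  intros H t. apply (filterlim_locally f (f t)). intros eps. exists eps. intros s Hs.
  change (Rabs (f s - f t) < eps). change (Rabs (s - t) < eps) in Hs.
  apply Rle_lt_trans with (2 := Hs). apply H.
Qed.

Lemma derive_nonneg_le (f df : R -> R) (a b : R) :
  a <= b ->
  (forall t, a <= t <= b -> is_derive f t (df t)) ->
  (forall t, a <= t <= b -> 0 <= df t) -> f a <= f b.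
Proof.
  intros Hab Hd Hp.
  destruct (MVT_gen f a b df) as [c [Hc E]].
  - rewrite Rmin_left, Rmax_right by lra. intros t Ht. apply Hd; lra.
  - rewrite Rmin_left, Rmax_right by lra. intros t Ht.
    apply continuous_continuity_pt, (is_derive_continuous _ _ (df t)), Hd; lra.
  - rewrite Rmin_left, Rmax_right in Hc by lra.
    assert (0 <= df c * (b - a)) by (apply Rmult_le_pos; [apply Hp; lra | lra]). lra.
Qed.

Lemma derive_zero_eq (f : R -> R) (a b : R) :
  a <= b -> (forall t, a <= t <= b -> is_derive f t 0) -> f a = f b.
Proof.
  intros Hab Hd. destruct (Req_dec a b) as [->|Hne]; [reflexivity|].
  apply (eq_is_derive f a b); [exact Hd | lra].
Qed.

Lemma ex_RInt_cont (f : R -> R) (a b : R) :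
  (forall t, continuous f t) -> ex_RInt f a b.
Proof. intros H. apply @ex_RInt_continuous. intros; apply H. Qed.

Lemma RInt_minus_R (f g : R -> R) (a b : R) :
  ex_RInt f a b -> ex_RInt g a b ->
  RInt (fun s => f s - g s) a b = RInt f a b - RInt g a b.
Proof. exact (RInt_minus f g a b). Qed.

Lemma RInt_const_R (c a b : R) : RInt (fun _ => c) a b = (b - a) * c.
Proof. exact (RInt_const a b c). Qed.

Lemma zero_between (f : R -> R) (a b : R) :
  a <= b -> (forall t, a <= t <= b -> continuity_pt f t) -> f a * f b <= 0 ->
  exists c, a <= c <= b /\ f c = 0.
Proof.
  intros Hab Hc Hs.
  destruct (Req_dec (f a) 0) as [E|Na]; [exists a; split; [lra|exact E]|].
  destruct (Req_dec (f b) 0) as [E|Nb]; [exists b; split; [lra|exact E]|].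
  assert (a < b).
  { destruct Hab as [|Heq]; [assumption|]. subst b. nra. }
  destruct (Rlt_dec (f a) 0) as [Ha|Ha].
  - destruct (Ranalysis5.IVT_interv f a b Hc) as [c [H1 H2]]; [assumption|assumption|nra|].
    now exists c.
  - destruct (Ranalysis5.IVT_interv (fun t => - f t) a b) as [c [H1 H2]]; [|assumption|lra|nra|].
    + intros t Ht. apply (continuity_pt_opp f). now apply Hc.
    + exists c. split; [assumption|lra].
Qed.

Lemma coefficient_nonpos (q M : R) : (forall S, 0 <= S -> S * q <= M) -> q <= 0.
Proof.
  intros H. apply Rnot_lt_le. intros Hq.
  pose proof (H 0 ltac:(lra)) as H0.
  specialize (H ((M + 1) / q)).
  assert (E : (M + 1) / q * q = M + 1) by (field; lra).
  assert (0 <= (M + 1) / q).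
  { apply Rmult_le_pos; [lra|]. left. now apply Rinv_0_lt_compat. }
  rewrite E in H. lra.
Qed.

Lemma increasing_limits_bound (p k : R -> R) (a b : R) :
  (forall t, is_derive p t (k t)) -> (forall t, 0 < k t) ->
  is_lim p p_infty b -> is_lim p m_infty a -> forall t, a <= p t <= b.
Proof.
  intros HD Hk Hb Ha t.
  assert (mono : forall s r, s <= r -> p s <= p r).
  { intros s r Hsr. apply (derive_nonneg_le p k); auto. intros q _. left; apply Hk. }
  split.
  - apply (is_lim_le_loc p (fun _ => p t) m_infty a (p t)); [|exact Ha | apply is_lim_const].
    exists t. intros s Hs. apply mono. lra.
  - apply (is_lim_le_loc (fun _ => p t) p p_infty (p t) b); [|apply is_lim_const | exact Hb].
    exists t. intros s Hs. apply mono. lra.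
Qed.

Lemma exp_le_compat (x y : R) : x <= y -> exp x <= exp y.
Proof. intros [H| ->]; [left; now apply exp_increasing | apply Rle_refl]. Qed.

(** * Global solutions of differential equations *)

(** The iteration runs for all time at once.  For each horizon [T] it suffices to know a box
    around the initial state that the iterates cannot leave before [T], and on which [F] is
    Lipschitz; boxes and constants may grow with [T].  The norm is the supremum of the
    coordinates, expressed by a common bound for all of them, so [J] is any type. *)
Section Picard.

Context {J : Type} (F : (J -> R) -> J -> R) (z0 : J -> R).

Definition box (r : J -> R) (z : J -> R) : Prop := forall j, Rabs (z j - z0 j) <= r j.

Definition stays_in_box (T : R) (r : J -> R) (C : R) : Prop :=
  forall z, box r z -> forall j, Rabs (F z j) <= C /\ T * Rabs (F z j) <= r j.

Definition lipschitz_on_box (r : J -> R) (L : R) : Prop :=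
  forall z z', box r z -> box r z' ->
  forall e, (forall j, Rabs (z j - z' j) <= e) ->
  forall j, Rabs (F z j - F z' j) <= L * e.

Context (F_continuous : forall Z : R -> J -> R,
  (forall t j, continuous (fun s => Z s j) t) ->
  forall t j, continuous (fun s => F (Z s) j) t).

Definition picard_step (Z : R -> J -> R) (t : R) (j : J) : R :=
  z0 j + RInt (fun s => F (Z s) j) 0 t.

Fixpoint picard (n : nat) : R -> J -> R :=
  match n with
  | O => fun _ => z0
  | S m => picard_step (picard m)
  end.

Lemma picard_step_derive (Z : R -> J -> R) (t : R) (j : J) :
  (forall t j, continuous (fun s => Z s j) t) ->
  is_derive (fun s => picard_step Z s j) t (F (Z t) j).
Proof.
  intros HZ. unfold picard_step.
  replace (F (Z t) j) with (0 + F (Z t) j) by ring.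
  apply (is_derive_plus (fun _ => z0 j) (fun s => RInt (fun s => F (Z s) j) 0 s)).
  - apply @is_derive_const.
  - apply (is_derive_RInt (fun s => F (Z s) j) _ 0 t).
    + apply filter_forall. intros b. apply @RInt_correct, ex_RInt_cont.
      intros s; now apply F_continuous.
    + now apply F_continuous.
Qed.

Lemma picard_continuous (n : nat) (t : R) (j : J) :
  continuous (fun s => picard n s j) t.
Proof.
  revert t j; induction n as [|n IH]; intros t j; simpl.
  - apply continuous_const.
  - eapply is_derive_continuous. now apply picard_step_derive.
Qed.

Section Horizon.

Context (T : R) (T_pos : 0 < T) (r : J -> R) (C L : R) (L_nonneg : 0 <= L)
  (in_box : stays_in_box T r C) (lip : lipschitz_on_box r L).

Lemma box_center : box r z0 <-> forall j, 0 <= r j.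
Proof.
  unfold box. split; intros H j; specialize (H j);
  rewrite Rminus_diag, Rabs_R0 in *; exact H.
Qed.

Context (r_nonneg : forall j, 0 <= r j).

Lemma picard_in_box (n : nat) (t : R) : 0 <= t <= T -> box r (picard n t).
Proof.
  revert t; induction n as [|n IH]; intros t Ht; simpl.
  - now apply box_center.
  - intros j. unfold picard_step. rewrite Rplus_minus_l.
    assert (H : Rabs (RInt (fun s => F (picard n s) j) 0 t) <= (t - 0) * (r j / T)).
    { apply abs_RInt_le_const; [lra| |].
      - apply ex_RInt_cont. intros s; apply F_continuous, picard_continuous.
      - intros s Hs. destruct (in_box (picard n s) (IH s ltac:(lra)) j) as [_ H].
        apply Rmult_le_reg_l with T; [lra|]. field_simplify; [exact H|lra]. }
    refine (Rle_trans _ _ _ H _).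
    specialize (r_nonneg j).
    replace ((t - 0) * (r j / T)) with (r j * (t / T)) by (field; lra).
    rewrite <- (Rmult_1_r (r j)) at 2. apply Rmult_le_compat_l; [lra|].
    apply Rmult_le_reg_r with T; [lra|]. field_simplify; lra.
Qed.

(** Relative to the weight [exp (rate * t)], each step of the iteration halves distances. *)
Definition rate : R := 2 * L + 1.

Lemma picard_contracts (n : nat) (t : R) (j : J) : 0 <= t <= T ->
  Rabs (picard (S n) t j - picard n t j) <= C * T * (/ 2) ^ n * exp (rate * t).
Proof.
  assert (HK : 0 < rate) by (unfold rate; lra).
  assert (HC : 0 <= C).
  { destruct (in_box z0 (proj2 box_center r_nonneg) j) as [H _].
    apply Rle_trans with (2 := H). apply Rabs_pos. }
  revert t j HC; induction n as [|n IH]; intros t j HC Ht.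
  - simpl picard. unfold picard_step.
    rewrite Rplus_minus_l, RInt_const_R.
    rewrite Rminus_0_r, Rabs_mult, (Rabs_pos_eq t), Rmult_1_r by lra.
    destruct (in_box z0 (proj2 box_center r_nonneg) j) as [H _].
    assert (E : 1 <= exp (rate * t)).
    { rewrite <- exp_0. apply exp_le_compat. apply Rmult_le_pos; lra. }
    apply Rle_trans with (T * C).
    + apply Rmult_le_compat; try lra. apply Rabs_pos.
    + rewrite <- (Rmult_1_r (T * C)), (Rmult_comm C T).
      apply Rmult_le_compat_l; [apply Rmult_le_pos; lra | exact E].
  - change (picard (S (S n)) t j) with (picard_step (picard (S n)) t j).
    change (picard (S n) t j) with (picard_step (picard n) t j). unfold picard_step at 1 2.
    set (A := C * T * (/ 2) ^ n).
    assert (HA : 0 <= A).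
    { apply Rmult_le_pos; [apply Rmult_le_pos; lra|]. apply pow_le; lra. }
    assert (c1 : forall m s, continuous (fun s => F (picard m s) j) s).
    { intros m s. apply F_continuous. intros; apply picard_continuous. }
    set (phi := fun s => L * A / rate * exp (rate * s)).
    set (dphi := fun s => L * (A * exp (rate * s))).
    assert (I : is_RInt dphi 0 t (phi t - phi 0)).
    { apply @is_RInt_derive.
      - intros s _. unfold phi, dphi. auto_derive; [trivial|]. field. lra.
      - intros s _. apply (ex_derive_continuous dphi s). unfold dphi. auto_derive. trivial. }
    rewrite Rminus_plus_l_l.
    rewrite <- RInt_minus_R by (apply ex_RInt_cont; apply c1).
    assert (B : Rabs (RInt (fun s => F (picard (S n) s) j - F (picard n s) j) 0 t) <= phi t - phi 0).
    { apply (norm_RInt_le (fun s => F (picard (S n) s) j - F (picard n s) j) dphi 0 t); [lra| | |exact I].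
      - intros s Hs. apply lip; try (apply picard_in_box; lra).
        intros i. apply IH; [exact HC | lra].
      - apply @RInt_correct, ex_RInt_cont. intros s.
        apply (continuous_minus (fun s => F (picard (S n) s) j) (fun s => F (picard n s) j)); apply c1. }
    refine (Rle_trans _ _ _ B _).
    unfold phi. rewrite Rmult_0_r, exp_0, Rmult_1_r.
    assert (E : 0 < exp (rate * t)) by apply exp_pos.
    assert (H1 : 0 <= L * A / rate).
    { apply Rmult_le_pos; [apply Rmult_le_pos; lra|]. left. now apply Rinv_0_lt_compat. }
    assert (H2 : L * A / rate <= A * / 2).
    { apply Rmult_le_reg_r with rate; [lra|]. field_simplify; [|lra]. unfold rate. lra. }
    apply Rle_trans with (L * A / rate * exp (rate * t)); [lra|].
    replace (C * T * (/ 2) ^ S n) with (A * / 2) by (unfold A; simpl; ring).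
    apply Rmult_le_compat_r; lra.
Qed.

(** Tail of the geometric series that bounds the distance of the iterates to their limit. *)
Definition gap (n : nat) : R := 2 * (C * T * exp (rate * T)) * (/ 2) ^ n.

Lemma picard_cauchy (n m : nat) (t : R) (j : J) : 0 <= t <= T ->
  Rabs (picard (n + m) t j - picard n t j) <= gap n.
Proof.
  intros Ht.
  assert (HC : 0 <= C).
  { destruct (in_box z0 (proj2 box_center r_nonneg) j) as [H _].
    apply Rle_trans with (2 := H). apply Rabs_pos. }
  assert (HD : 0 <= C * T * exp (rate * T)).
  { apply Rmult_le_pos; [apply Rmult_le_pos; lra|]. left; apply exp_pos. }
  unfold gap. set (D := C * T * exp (rate * T)) in *.
  assert (S1 : forall k, Rabs (picard (S k) t j - picard k t j) <= D * (/2) ^ k).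
  { intros k. refine (Rle_trans _ _ _ (picard_contracts k t j Ht) _).
    replace (D * (/2)^k) with (C * T * (/2)^k * exp (rate * T)) by (unfold D; ring).
    apply Rmult_le_compat_l.
    - apply Rmult_le_pos; [apply Rmult_le_pos; lra|]. apply pow_le; lra.
    - apply exp_le_compat. apply Rmult_le_compat_l; unfold rate; lra. }
  assert (H : Rabs (picard (n + m) t j - picard n t j) <= 2 * D * ((/2)^n - (/2)^(n+m))).
  { induction m as [|m IH].
    - rewrite Nat.add_0_r, 2 Rminus_diag, Rabs_R0. lra.
    - rewrite Nat.add_succ_r.
      replace (picard (S (n + m)) t j - picard n t j) with
        ((picard (S (n + m)) t j - picard (n + m) t j) + (picard (n + m) t j - picard n t j)) by ring.
      refine (Rle_trans _ _ _ (Rabs_triang _ _) _).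
      specialize (S1 (n + m)%nat).
      change ((/2)^(S (n+m))) with (/2 * (/2)^(n+m)). lra. }
  refine (Rle_trans _ _ _ H _).
  assert (0 <= (/2)^(n+m)) by (apply pow_le; lra).
  apply Rmult_le_compat_l; lra.
Qed.

Lemma gap_lim : is_lim_seq gap 0.
Proof.
  unfold gap.
  replace (Finite 0) with (Rbar_mult (2 * (C * T * exp (rate * T))) 0)
    by (simpl; f_equal; ring).
  apply is_lim_seq_scal_l. apply is_lim_seq_geom.
  rewrite Rabs_pos_eq; lra.
Qed.

Lemma picard_converges (t : R) (j : J) : 0 <= t <= T ->
  ex_finite_lim_seq (fun n => picard n t j).
Proof.
  intros Ht. apply ex_lim_seq_cauchy_corr. intros eps.
  destruct (proj2 (is_lim_seq_spec _ _) gap_lim (pos_div_2 eps)) as [N HN].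
  assert (G : gap N < eps / 2).
  { specialize (HN N (le_n N)). simpl in HN. rewrite Rminus_0_r in HN.
    apply Rle_lt_trans with (2 := HN). apply Rle_abs. }
  exists N. intros n m Hn Hm.
  replace (picard n t j - picard m t j) with
    ((picard (N + (n - N)) t j - picard N t j) + - (picard (N + (m - N)) t j - picard N t j)).
  2:{ replace (N + (n - N))%nat with n by lia. replace (N + (m - N))%nat with m by lia. ring. }
  refine (Rle_lt_trans _ _ _ (Rabs_triang _ _) _). rewrite Rabs_Ropp.
  pose proof (picard_cauchy N (n - N) t j Ht). pose proof (picard_cauchy N (m - N) t j Ht). lra.
Qed.

Lemma picard_lipschitz (n : nat) (s t : R) (j : J) :
  0 <= s <= T -> 0 <= t <= T ->
  Rabs (picard n t j - picard n s j) <= C * Rabs (t - s).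
Proof.
  intros Hs Ht.
  assert (HC : 0 <= C).
  { destruct (in_box z0 (proj2 box_center r_nonneg) j) as [H _].
    apply Rle_trans with (2 := H). apply Rabs_pos. }
  destruct n as [|n].
  - simpl. rewrite Rminus_diag, Rabs_R0. apply Rmult_le_pos; [exact HC | apply Rabs_pos].
  - destruct (MVT_gen (fun t => picard (S n) t j) s t (fun t => F (picard n t) j)) as [c [Hc E]].
    + intros u Hu. apply picard_step_derive. intros; apply picard_continuous.
    + intros u Hu. apply continuous_continuity_pt, picard_continuous.
    + rewrite E, Rabs_mult. apply Rmult_le_compat_r; [apply Rabs_pos|].
      apply in_box, picard_in_box.
      revert Hc; unfold Rmin, Rmax; destruct (Rle_dec s t); lra.
Qed.

End Horizon.

Context (global : forall T, 0 < T -> exists (r : J -> R) (C L : R),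
  (forall j, 0 <= r j) /\ 0 <= L /\ stays_in_box T r C /\ lipschitz_on_box r L).

(** Before time [0] the limit is frozen at its initial value: it is then continuous on the whole
    line, and one more iteration yields two-sided derivatives, also at [0]. *)
Definition picard_limit (t : R) (j : J) : R := real (Lim_seq (fun n => picard n (Rmax 0 t) j)).

Lemma picard_limit_correct (t : R) (j : J) :
  is_lim_seq (fun n => picard n (Rmax 0 t) j) (picard_limit t j).
Proof.
  assert (H : 0 <= Rmax 0 t) by apply Rmax_l.
  destruct (global (Rmax 0 t + 1)) as [r [C [L [r0 [L0 [HB HL]]]]]]; [lra|].
  apply Lim_seq_correct'.
  apply (picard_converges (Rmax 0 t + 1) ltac:(lra) r C L L0 HB HL r0). lra.
Qed.

Lemma picard_limit_in_box (T : R) (T_pos : 0 < T) (r : J -> R) (C : R)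
  (in_box : stays_in_box T r C) (r_nonneg : forall j, 0 <= r j) (t : R) :
  0 <= t <= T -> box r (picard_limit t).
Proof.
  intros Ht i.
  pose proof (picard_limit_correct t i) as Lm. rewrite Rmax_right in Lm by lra.
  apply (is_lim_seq_le (fun m => Rabs (picard m t i - z0 i)) (fun _ => r i)
           (Rabs (picard_limit t i - z0 i)) (r i)).
  - intros m. now apply (picard_in_box T T_pos r C in_box r_nonneg).
  - apply (is_lim_seq_abs _ (picard_limit t i - z0 i)).
    apply is_lim_seq_minus'; [exact Lm | apply is_lim_seq_const].
  - apply is_lim_seq_const.
Qed.

Lemma picard_limit_continuous (t : R) (j : J) : continuous (fun s => picard_limit s j) t.
Proof.
  assert (H : 0 <= Rmax 0 t) by apply Rmax_l.
  destruct (global (Rmax 0 t + 1)) as [r [C [L [r0 [L0 [HB HL]]]]]]; [lra|].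
  assert (HC : 0 <= C).
  { destruct (HB z0 (proj2 (box_center r) r0) j) as [H' _].
    apply Rle_trans with (2 := H'). apply Rabs_pos. }
  assert (K : forall s, Rabs (s - t) < 1 ->
              Rabs (picard_limit s j - picard_limit t j) <= C * Rabs (s - t)).
  { intros s Hs. pose proof (Rmax_contraction 0 s t).
    assert (Rmax 0 s <= Rmax 0 t + 1).
    { pose proof (Rle_abs (Rmax 0 s - Rmax 0 t)). lra. }
    assert (0 <= Rmax 0 s) by apply Rmax_l.
    apply (is_lim_seq_le (fun n => Rabs (picard n (Rmax 0 s) j - picard n (Rmax 0 t) j))
             (fun _ => C * Rabs (s - t))
             (Rabs (picard_limit s j - picard_limit t j)) (C * Rabs (s - t))).
    - intros n. apply Rle_trans with (C * Rabs (Rmax 0 s - Rmax 0 t)).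
      + apply (picard_lipschitz (Rmax 0 t + 1) ltac:(lra) r C HB r0); lra.
      + now apply Rmult_le_compat_l.
    - apply (is_lim_seq_abs (fun n => picard n (Rmax 0 s) j - picard n (Rmax 0 t) j)
               (picard_limit s j - picard_limit t j)).
      apply is_lim_seq_minus'; apply picard_limit_correct.
    - apply is_lim_seq_const. }
  apply (filterlim_locally (fun s => picard_limit s j) (picard_limit t j)). intros eps.
  assert (HD : 0 < Rmin 1 (eps / (C + 1))).
  { apply Rmin_pos; [lra|]. apply Rdiv_lt_0_compat; [apply cond_pos | lra]. }
  exists (mkposreal _ HD). intros s Hs. change (Rabs (s - t) < Rmin 1 (eps / (C + 1))) in Hs.
  change (Rabs (picard_limit s j - picard_limit t j) < eps).
  pose proof (Rmin_l 1 (eps / (C + 1))). pose proof (Rmin_r 1 (eps / (C + 1))).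
  refine (Rle_lt_trans _ _ _ (K s ltac:(lra)) _).
  apply Rle_lt_trans with ((C + 1) * Rabs (s - t)).
  - apply Rmult_le_compat_r; [apply Rabs_pos | lra].
  - replace (pos eps) with ((C + 1) * (eps / (C + 1))) by (field; lra).
    apply Rmult_lt_compat_l; lra.
Qed.

Lemma picard_limit_fixed (t : R) (j : J) : 0 <= t ->
  picard_limit t j = picard_step picard_limit t j.
Proof.
  intros Ht.
  destruct (global (t + 1)) as [r [C [L [r0 [L0 [HB HL]]]]]]; [lra|].
  pose proof (gap_lim (t + 1) C L) as G.
  assert (close : forall n s i, 0 <= s <= t -> Rabs (picard n s i - picard_limit s i) <= gap (t + 1) C L n).
  { intros n s i Hs.
    apply (is_lim_seq_le (fun m => Rabs (picard n s i - picard (n + m) s i)) (fun _ => gap (t + 1) C L n)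
             (Rabs (picard n s i - picard_limit s i)) (gap (t + 1) C L n)).
    - intros m. rewrite Rabs_minus_sym.
      apply (picard_cauchy (t + 1) ltac:(lra) r C L L0 HB HL r0). lra.
    - apply (is_lim_seq_abs _ (picard n s i - picard_limit s i)).
      apply is_lim_seq_minus'; [apply is_lim_seq_const|].
      pose proof (picard_limit_correct s i) as Lm. rewrite Rmax_right in Lm by lra.
      apply (is_lim_seq_incr_n _ n) in Lm.
      apply is_lim_seq_ext with (2 := Lm). intros m. now rewrite Nat.add_comm.
    - apply is_lim_seq_const. }
  assert (limbox : forall s, 0 <= s <= t -> box r (picard_limit s)).
  { intros s Hs. apply (picard_limit_in_box (t + 1) ltac:(lra) r C HB r0). lra. }
  assert (L1 : is_lim_seq (fun n => picard (S n) t j) (picard_limit t j)).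
  { pose proof (picard_limit_correct t j) as Lm. rewrite Rmax_right in Lm by lra.
    now apply (is_lim_seq_incr_1 (fun n => picard n t j)). }
  assert (L2 : is_lim_seq (fun n => picard (S n) t j) (picard_step picard_limit t j)).
  { apply is_lim_seq_ext with
      (fun n => picard_step picard_limit t j + (picard (S n) t j - picard_step picard_limit t j)).
    { intros n; ring. }
    replace (Finite (picard_step picard_limit t j))
      with (Finite (picard_step picard_limit t j + 0)) by (f_equal; ring).
    apply is_lim_seq_plus'; [apply is_lim_seq_const|].
    apply is_lim_seq_abs_0.
    apply is_lim_seq_le_le with (u := fun _ => 0) (w := fun n => t * L * gap (t + 1) C L n).
    - intros n. split; [apply Rabs_pos|]. simpl. unfold picard_step.
      assert (c1 : forall s, continuous (fun s => F (picard n s) j) s).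
      { intros s. apply F_continuous. intros; apply picard_continuous. }
      assert (c2 : forall s, continuous (fun s => F (picard_limit s) j) s).
      { intros s. apply F_continuous. intros; apply picard_limit_continuous. }
      rewrite Rminus_plus_l_l.
      rewrite <- RInt_minus_R by (apply ex_RInt_cont; assumption).
      replace (t * L * gap (t + 1) C L n) with ((t - 0) * (L * gap (t + 1) C L n)) by ring.
      apply abs_RInt_le_const; [lra| |].
      + apply ex_RInt_cont. intros s.
        now apply (continuous_minus (fun s => F (picard n s) j) (fun s => F (picard_limit s) j)).
      + intros s Hs. apply HL.
        * apply (picard_in_box (t + 1) ltac:(lra) r C HB r0). lra.
        * now apply limbox.
        * intros i. now apply close.
    - apply is_lim_seq_const.
    - replace (Finite 0) with (Rbar_mult (t * L) 0) by (simpl; f_equal; ring).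
      now apply is_lim_seq_scal_l. }
  apply is_lim_seq_unique in L1. apply is_lim_seq_unique in L2.
  rewrite L1 in L2. now injection L2.
Qed.

Theorem global_solution : exists Z : R -> J -> R,
  (forall j, Z 0 j = z0 j) /\
  forall t, 0 <= t -> forall j, is_derive (fun s => Z s j) t (F (Z t) j).
Proof.
  exists (picard_step picard_limit). split.
  - intros j. unfold picard_step. rewrite RInt_point. unfold zero; simpl. ring.
  - intros t Ht j.
    replace (picard_step picard_limit t) with (picard_limit t)
      by (apply functional_extensionality; intros i; now apply picard_limit_fixed).
    apply picard_step_derive. intros; apply picard_limit_continuous.
Qed.

End Picard.

(** * Variation of a function that turns once *)

Section Variation.

Context (P dP : R -> R) (a b : R)
  (P_bounds : forall t, a <= P t <= b).

(** Half the derivative of [P ^ 2] is [P * P'].  If [P] took both signs, it would vanish in between,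
    and a monotone [P ^ 2] could not be positive on both sides of this zero. *)
Lemma square_monotone_keeps_sign (r t : R) :
  (forall s, r <= s <= t -> is_derive P s (dP s)) ->
  (forall s, r <= s <= t -> 0 <= P s * dP s) \/
  (forall s, r <= s <= t -> P s * dP s <= 0) ->
  (forall s, r <= s <= t -> 0 <= P s) \/ (forall s, r <= s <= t -> P s <= 0).
Proof.
  intros HD HS.
  destruct (classic (exists s, r <= s <= t /\ P s < 0)) as [[s1 [B1 N1]]|No].
  2:{ left. intros s Hs. apply Rnot_lt_le. intros Hlt. apply No. now exists s. }
  destruct (classic (exists s, r <= s <= t /\ 0 < P s)) as [[s2 [B2 N2]]|No].
  2:{ right. intros s Hs. apply Rnot_lt_le. intros Hlt. apply No. now exists s. }
  exfalso.
  assert (D2 : forall s, r <= s <= t -> is_derive (fun s => P s * P s) s (2 * (P s * dP s))).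
  { intros s Hs. evar_last.
    - apply (is_derive_mult P P s (dP s) (dP s)); try (now apply HD).
      intros; apply Rmult_comm.
    - unfold plus, mult; simpl. ring. }
  assert (step : forall s s', r <= s -> s <= s' -> s' <= t -> P s * P s' < 0 -> False).
  { intros s s' H1 H2 H3 H4.
    destruct (zero_between P s s') as [c [Hc Ec]]; [assumption| |lra|].
    - intros u Hu. apply continuous_continuity_pt, (is_derive_continuous _ _ (dP u)), HD. lra.
    - destruct HS as [HS|HS].
      + pose proof (derive_nonneg_le (fun s => P s * P s) (fun s => 2 * (P s * dP s)) s c) as M.
        assert (P s * P s <= P c * P c).
        { apply M; [lra| |]; intros u Hu; [apply D2; lra|]. specialize (HS u); lra. }
        rewrite Ec in *. nra.
      + pose proof (derive_nonneg_le (fun s => - (P s * P s)) (fun s => - (2 * (P s * dP s))) c s') as M.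
        assert (- (P c * P c) <= - (P s' * P s')).
        { apply M; [lra| |]; intros u Hu.
          - apply (is_derive_opp (fun s => P s * P s)). apply D2; lra.
          - specialize (HS u); lra. }
        rewrite Ec in *. nra. }
  destruct (Rle_dec s1 s2) as [Hle|Hle].
  - apply (step s1 s2); try lra; nra.
  - apply (step s2 s1); try lra; nra.
Qed.

Lemma derive_zero_at_minimum (r t s : R) : r < s < t -> P s = 0 ->
  (forall u, r <= u <= t -> 0 <= P u) \/ (forall u, r <= u <= t -> P u <= 0) ->
  is_derive P s (dP s) -> dP s = 0.
Proof.
  intros Hs E HP HD.
  apply is_derive_Reals in HD.
  pose (pr := exist _ (dP s) HD : derivable_pt P s).
  change (dP s) with (derive_pt P s pr).
  destruct HP as [HP|HP].
  - apply (deriv_minimum P r t s pr); try lra. intros u H1 H2. rewrite E. apply HP; lra.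
  - apply (deriv_maximum P r t s pr); try lra. intros u H1 H2. rewrite E. apply HP; lra.
Qed.

(** Since [P] keeps its sign, so does its derivative: where [P] vanishes inside the interval it
    has an extremum.  The variation is therefore the difference of the values at the ends. *)
Lemma monotone_variation (r t : R) : r <= t ->
  (forall s, r <= s <= t -> is_derive P s (dP s)) ->
  (forall s, r <= s <= t -> continuous dP s) ->
  (forall s, r <= s <= t -> 0 <= P s * dP s) \/
  (forall s, r <= s <= t -> P s * dP s <= 0) ->
  RInt (fun s => Rabs (dP s)) r t <= b - a.
Proof.
  intros Hrt HD HC HS.
  pose proof (square_monotone_keeps_sign r t HD HS) as Sg.
  assert (I : RInt dP r t = P t - P r).
  { apply is_RInt_unique. apply (is_RInt_derive P dP);
    rewrite Rmin_left, Rmax_right by lra; assumption. }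
  assert (X : ex_RInt dP r t).
  { apply @ex_RInt_continuous. rewrite Rmin_left, Rmax_right by lra. assumption. }
  assert (K : (forall s, r < s < t -> 0 <= dP s) \/ (forall s, r < s < t -> dP s <= 0)).
  { assert (Z : forall s, r < s < t -> P s = 0 -> dP s = 0).
    { intros s Hs E. apply (derive_zero_at_minimum r t s Hs E Sg). apply HD; lra. }
    destruct Sg as [Sg|Sg], HS as [HS|HS]; [left|right|right|left]; intros s Hs;
    (destruct (Req_dec (P s) 0) as [E|E]; [rewrite (Z s Hs E); lra|]);
    specialize (Sg s ltac:(lra)); specialize (HS s ltac:(lra)); nra. }
  pose proof (P_bounds t). pose proof (P_bounds r).
  destruct K as [K|K].
  - rewrite (RInt_ext (fun s => Rabs (dP s)) dP); [lra|].
    rewrite Rmin_left, Rmax_right by lra. intros s Hs. apply Rabs_pos_eq; auto.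
  - rewrite (RInt_ext (fun s => Rabs (dP s)) (fun s => - dP s)).
    + pose proof (RInt_opp dP r t X) as O. change (RInt (fun s => - dP s) r t = - RInt dP r t) in O. lra.
    + rewrite Rmin_left, Rmax_right by lra. intros s Hs.
      apply Rabs_left1. auto.
Qed.

(** The function [m] carries the sign of the derivative of [P ^ 2]; being nondecreasing, it
    splits the interval into two on which [monotone_variation] applies.  Its zeros, not those of
    the derivative of [P], are used because [P] may cross [0] at an arbitrary speed. *)
Lemma unimodal_variation (m : R -> R) (s t : R) : s <= t ->
  (forall r, s <= r <= t -> is_derive P r (dP r)) ->
  (forall r, s <= r <= t -> continuous dP r) ->
  (forall r, s <= r <= t -> continuity_pt m r) ->
  (forall r r', s <= r -> r <= r' -> r' <= t -> m r <= m r') ->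
  (forall r, s <= r <= t -> 0 <= m r -> 0 <= P r * dP r) ->
  (forall r, s <= r <= t -> m r <= 0 -> P r * dP r <= 0) ->
  RInt (fun r => Rabs (dP r)) s t <= 2 * (b - a).
Proof.
  intros Hst HD HC Hm Mon Hp Hn.
  assert (0 <= b - a) by (pose proof (P_bounds s); lra).
  destruct (Rle_dec 0 (m s)) as [H0|H0].
  { apply Rle_trans with (b - a); [|lra]. apply monotone_variation; try assumption.
    left. intros r Hr. apply Hp; [assumption|]. specialize (Mon s r); lra. }
  destruct (Rle_dec (m t) 0) as [H1|H1].
  { apply Rle_trans with (b - a); [|lra]. apply monotone_variation; try assumption.
    right. intros r Hr. apply Hn; [assumption|]. specialize (Mon r t); lra. }
  destruct (zero_between m s t) as [c [Hc Ec]]; [assumption|assumption|nra|].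
  assert (X : forall r r', s <= r <= t -> s <= r' <= t -> ex_RInt (fun u => Rabs (dP u)) r r').
  { intros r r' Hr Hr'. apply @ex_RInt_continuous. intros u Hu.
    apply (continuous_comp dP Rabs).
    - apply HC. revert Hu. unfold Rmin, Rmax; destruct (Rle_dec r r'); lra.
    - apply continuous_Rabs. }
  rewrite <- (RInt_Chasles (fun u => Rabs (dP u)) s c t) by (apply X; lra).
  unfold plus; simpl.
  assert (RInt (fun u => Rabs (dP u)) s c <= b - a).
  { apply monotone_variation; [lra| | |].
    - intros r Hr; apply HD; lra.
    - intros r Hr; apply HC; lra.
    - right. intros r Hr. apply Hn; [lra|]. specialize (Mon r c); lra. }
  assert (RInt (fun u => Rabs (dP u)) c t <= b - a).
  { apply monotone_variation; [lra| | |].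
    - intros r Hr; apply HD; lra.
    - intros r Hr; apply HC; lra.
    - left. intros r Hr. apply Hp; [lra|]. specialize (Mon c r); lra. }
  lra.
Qed.

End Variation.

(** * Turning of the tangent of a geodesic *)

(** The determinant of the metric, and the squared length of the normal [(- p x, p y, 1)]. *)
Definition area_factor (p : R -> R) (x y : R) : R := 1 + p x * p x + p y * p y.

(** The second fundamental form of the velocity, divided by the length of the normal of
    [area_factor]: the acceleration in space is [bending] times this normal. *)
Definition bending (p k : R -> R) (x y u v : R) : R :=
  (k x * u * u - k y * v * v) / area_factor p x y.

(** The vertical component of the tangent vector with horizontal components [u] and [v]. *)
Definition rise (p : R -> R) (x y u v : R) : R := p x * u - p y * v.

(** The geodesic equation of the graph, for a curve of unit speed in space. *)
Record geodesic_at (p k : R -> R) (x y u v : R -> R) (t : R) : Prop := {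
  geo_x : is_derive x t (u t);
  geo_y : is_derive y t (v t);
  geo_u : is_derive u t (- p (x t) * bending p k (x t) (y t) (u t) (v t));
  geo_v : is_derive v t (p (y t) * bending p k (x t) (y t) (u t) (v t));
  geo_unit : u t * u t + v t * v t
             + rise p (x t) (y t) (u t) (v t) * rise p (x t) (y t) (u t) (v t) = 1
}.

Lemma area_factor_ge1 (p : R -> R) (x y : R) : 1 <= area_factor p x y.
Proof. unfold area_factor. nra. Qed.

(** Unit vectors at distance at most [4 (b - a)] have at least this inner product. *)
Definition turning_constant (a b : R) : R := 1 - 8 * (b - a) ^ 2.

Lemma turning_constant_pos (a b : R) : b - a = PI / 10 -> 0 < turning_constant a b.
Proof.
  unfold turning_constant. intros ->.
  (* The partial sum 1 - 1/3 + 1/5 of Leibniz's series: PI <= 52/15 < 5 / sqrt 2. *)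
  pose proof (PI_ineq 1) as [_ H]. unfold tg_alt, PI_tg in H. simpl in H.
  pose proof PI_RGT_0.
  assert (PI <= 3.5) by lra.
  nra.
Qed.

Section Turning.

Context (p k : R -> R) (a b : R)
  (p_derive : forall t, is_derive p t (k t))
  (k_continuous : forall t, continuous k t)
  (k_pos : forall t, 0 < k t)
  (p_bounds : forall t, a <= p t <= b).

(** The product [p (q r) * v r] is the derivative of the height [g (q r)], and [climb'] its second
    derivative: the height is convex and turns at most once.  As [k] is positive, the product has
    the sign of the derivative of [p (q r) ^ 2]. *)
Lemma slope_variation (q v climb' : R -> R) (s t : R) : s <= t ->
  (forall r, s <= r <= t -> is_derive q r (v r)) ->
  (forall r, s <= r <= t -> continuous v r) ->
  (forall r, s <= r <= t -> is_derive (fun r => p (q r) * v r) r (climb' r)) ->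
  (forall r, 0 <= climb' r) ->
  RInt (fun r => Rabs (k (q r) * v r)) s t <= 2 * (b - a).
Proof.
  intros Hst Dq Cv Dc Hc.
  assert (E : forall r, p (q r) * (k (q r) * v r) = k (q r) * (p (q r) * v r)) by (intros; ring).
  apply (unimodal_variation (fun r => p (q r)) (fun r => k (q r) * v r) a b
           (fun r => p_bounds (q r)) (fun r => p (q r) * v r)); try assumption.
  - intros r Hr. apply is_derive_Rcomp; [apply p_derive | now apply Dq].
  - intros r Hr. apply (continuous_mult (fun r => k (q r)) v); [|now apply Cv].
    apply (continuous_comp q k); [|apply k_continuous].
    eapply is_derive_continuous, Dq, Hr.
  - intros r Hr. eapply continuous_continuity_pt, is_derive_continuous, Dc, Hr.
  - intros r r' H1 H2 H3. apply (derive_nonneg_le (fun r => p (q r) * v r) climb' r r' H2).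
    + intros r0 Hr0. apply Dc. lra.
    + intros r0 _. apply Hc.
  - intros r _ H. pose proof (k_pos (q r)). rewrite E. apply Rmult_le_pos; lra.
  - intros r _ H. pose proof (k_pos (q r)). rewrite E. nra.
Qed.

Section Curve.

Context (x y u v : R -> R).

Definition bend (t : R) : R := bending p k (x t) (y t) (u t) (v t).
Definition rise_along (t : R) : R := rise p (x t) (y t) (u t) (v t).

Lemma slope_x_derive (t : R) : geodesic_at p k x y u v t ->
  is_derive (fun s => p (x s)) t (k (x t) * u t).
Proof. intros H. apply is_derive_Rcomp; [apply p_derive | apply (geo_x _ _ _ _ _ _ _ H)]. Qed.

Lemma slope_y_derive (t : R) : geodesic_at p k x y u v t ->
  is_derive (fun s => p (y s)) t (k (y t) * v t).
Proof. intros H. apply is_derive_Rcomp; [apply p_derive | apply (geo_y _ _ _ _ _ _ _ H)]. Qed.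

(** The normal of [area_factor] has vertical component one. *)
Lemma rise_derive (t : R) : geodesic_at p k x y u v t -> is_derive rise_along t (bend t).
Proof.
  intros H. eapply is_derive_eq.
  - apply is_derive_Rminus; apply is_derive_Rmult.
    + now apply slope_x_derive.
    + apply (geo_u _ _ _ _ _ _ _ H).
    + now apply slope_y_derive.
    + apply (geo_v _ _ _ _ _ _ _ H).
  - unfold bend, bending. pose proof (area_factor_ge1 p (x t) (y t)) as A.
    unfold area_factor in *. field. lra.
Qed.

Definition climb_x' (t : R) : R := k (x t) * u t * u t - p (x t) * p (x t) * bend t.
Definition climb_y' (t : R) : R := k (y t) * v t * v t + p (y t) * p (y t) * bend t.

Lemma climb_x_derive (t : R) : geodesic_at p k x y u v t ->
  is_derive (fun s => p (x s) * u s) t (climb_x' t).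
Proof.
  intros H. eapply is_derive_eq.
  - apply is_derive_Rmult; [now apply slope_x_derive | apply (geo_u _ _ _ _ _ _ _ H)].
  - unfold climb_x', bend. ring.
Qed.

Lemma climb_y_derive (t : R) : geodesic_at p k x y u v t ->
  is_derive (fun s => p (y s) * v s) t (climb_y' t).
Proof.
  intros H. eapply is_derive_eq.
  - apply is_derive_Rmult; [now apply slope_y_derive | apply (geo_v _ _ _ _ _ _ _ H)].
  - unfold climb_y', bend. ring.
Qed.

(** The negative contribution of the bending is at most the share [p (x t) ^ 2 / W] of the
    positive first term. *)
Lemma climb_x_convex (t : R) : 0 <= climb_x' t.
Proof.
  unfold climb_x', bend, bending. pose proof (area_factor_ge1 p (x t) (y t)) as A.
  pose proof (k_pos (x t)). pose proof (k_pos (y t)).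
  apply Rmult_le_reg_r with (area_factor p (x t) (y t)); [lra|].
  replace ((k (x t) * u t * u t - p (x t) * p (x t) *
     ((k (x t) * u t * u t - k (y t) * v t * v t) / area_factor p (x t) (y t))) * area_factor p (x t) (y t))
    with (k (x t) * (u t * u t) * (1 + p (y t) * p (y t)) + k (y t) * (v t * v t) * (p (x t) * p (x t)))
    by (unfold area_factor in *; field; lra).
  rewrite Rmult_0_l.
  pose proof (Rle_0_sqr (u t)). pose proof (Rle_0_sqr (v t)).
  pose proof (Rle_0_sqr (p (x t))). pose proof (Rle_0_sqr (p (y t))). unfold Rsqr in *.
  apply Rplus_le_le_0_compat; (apply Rmult_le_pos; [apply Rmult_le_pos|]); lra.
Qed.

Lemma climb_y_convex (t : R) : 0 <= climb_y' t.
Proof.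
  unfold climb_y', bend, bending. pose proof (area_factor_ge1 p (x t) (y t)) as A.
  pose proof (k_pos (x t)). pose proof (k_pos (y t)).
  apply Rmult_le_reg_r with (area_factor p (x t) (y t)); [lra|].
  replace ((k (y t) * v t * v t + p (y t) * p (y t) *
     ((k (x t) * u t * u t - k (y t) * v t * v t) / area_factor p (x t) (y t))) * area_factor p (x t) (y t))
    with (k (y t) * (v t * v t) * (1 + p (x t) * p (x t)) + k (x t) * (u t * u t) * (p (y t) * p (y t)))
    by (unfold area_factor in *; field; lra).
  rewrite Rmult_0_l.
  pose proof (Rle_0_sqr (u t)). pose proof (Rle_0_sqr (v t)).
  pose proof (Rle_0_sqr (p (x t))). pose proof (Rle_0_sqr (p (y t))). unfold Rsqr in *.
  apply Rplus_le_le_0_compat; (apply Rmult_le_pos; [apply Rmult_le_pos|]); lra.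
Qed.

Context (s t : R) (Hst : s <= t)
  (geo : forall r, s <= r <= t -> geodesic_at p k x y u v r).

Lemma continuous_along (r : R) : s <= r <= t ->
  (continuous x r /\ continuous y r) /\ (continuous u r /\ continuous v r).
Proof.
  intros Hr. specialize (geo r Hr).
  repeat split; eapply is_derive_continuous;
  [apply (geo_x _ _ _ _ _ _ _ geo) | apply (geo_y _ _ _ _ _ _ _ geo)
  |apply (geo_u _ _ _ _ _ _ _ geo) | apply (geo_v _ _ _ _ _ _ _ geo)].
Qed.

(** Test the curve against the displacement [d] of its tangent.  The derivative of the inner
    product of [d] with the tangent is [bend] times that of [d] with the normal, hence is at most
    the length [A] of [d] times the rate of variation of the two slopes; it integrates to
    [A ^ 2]. *)
Lemma tangent_turning :
  (u t - u s) ^ 2 + (v t - v s) ^ 2 + (rise_along t - rise_along s) ^ 2 <= (4 * (b - a)) ^ 2.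
Proof.
  set (d1 := u t - u s). set (d2 := v t - v s). set (d3 := rise_along t - rise_along s).
  set (A := sqrt (d1 ^ 2 + d2 ^ 2 + d3 ^ 2)).
  assert (HA : 0 <= A) by apply sqrt_pos.
  assert (HA2 : A * A = d1 ^ 2 + d2 ^ 2 + d3 ^ 2) by (apply sqrt_sqrt; nra).
  set (psi := fun r => d1 * u r + d2 * v r + d3 * rise_along r).
  set (N := fun r => - d1 * p (x r) + d2 * p (y r) + d3).
  set (dpsi := fun r => N r * bend r).
  assert (Dpsi : forall r, s <= r <= t -> is_derive psi r (dpsi r)).
  { intros r Hr. eapply is_derive_eq.
    - apply is_derive_Rplus; [apply is_derive_Rplus|]; apply is_derive_Rscal.
      + apply (geo_u _ _ _ _ _ _ _ (geo r Hr)).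
      + apply (geo_v _ _ _ _ _ _ _ (geo r Hr)).
      + apply rise_derive, geo, Hr.
    - unfold dpsi, N, bend. ring. }
  assert (cl : forall r, s <= r <= t ->
    (continuous (fun r => k (x r) * u r) r /\ continuous (fun r => k (y r) * v r) r)
    /\ continuous dpsi r).
  { intros r Hr. destruct (continuous_along r Hr) as [[cx cy] [cu cv]].
    assert (c1 : continuous (fun r => k (x r) * u r) r).
    { apply (continuous_mult (fun r => k (x r)) u); [|assumption]. now apply (continuous_comp x k). }
    assert (c2 : continuous (fun r => k (y r) * v r) r).
    { apply (continuous_mult (fun r => k (y r)) v); [|assumption]. now apply (continuous_comp y k). }
    assert (c3 : continuous (fun r => p (x r)) r).
    { eapply is_derive_continuous, slope_x_derive, geo, Hr. }
    assert (c4 : continuous (fun r => p (y r)) r).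
    { eapply is_derive_continuous, slope_y_derive, geo, Hr. }
    repeat split; try assumption.
    unfold dpsi, N, bend, bending, Rdiv.
    apply (continuous_mult (fun r => - d1 * p (x r) + d2 * p (y r) + d3)
      (fun r => (k (x r) * u r * u r - k (y r) * v r * v r) * / area_factor p (x r) (y r))).
    - apply (continuous_plus (fun r => - d1 * p (x r) + d2 * p (y r)) (fun _ => d3)); [|apply continuous_const].
      apply (continuous_plus (fun r => - d1 * p (x r)) (fun r => d2 * p (y r))).
      + now apply (continuous_scal_r (- d1) (fun r => p (x r))).
      + now apply (continuous_scal_r d2 (fun r => p (y r))).
    - apply (continuous_mult (fun r => k (x r) * u r * u r - k (y r) * v r * v r)
              (fun r => / area_factor p (x r) (y r))).
      + apply (continuous_minus (fun r => k (x r) * u r * u r) (fun r => k (y r) * v r * v r)).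
        * now apply (continuous_mult (fun r => k (x r) * u r) u).
        * now apply (continuous_mult (fun r => k (y r) * v r) v).
      + apply continuous_Rinv_comp.
        * unfold area_factor. apply (continuous_plus (fun r => 1 + p (x r) * p (x r)) (fun r => p (y r) * p (y r))).
          -- apply (continuous_plus (fun _ => 1) (fun r => p (x r) * p (x r))); [apply continuous_const|].
             now apply (continuous_mult (fun r => p (x r)) (fun r => p (x r))).
          -- now apply (continuous_mult (fun r => p (y r)) (fun r => p (y r))).
        * pose proof (area_factor_ge1 p (x r) (y r)). lra. }
  assert (Ipsi : is_RInt dpsi s t (psi t - psi s)).
  { apply (is_RInt_derive psi dpsi); rewrite Rmin_left, Rmax_right by lra; [assumption|].
    intros r Hr. apply cl, Hr. }
  set (V := fun r => A * (Rabs (k (x r) * u r) + Rabs (k (y r) * v r))).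
  assert (E1 : ex_RInt (fun r => Rabs (k (x r) * u r)) s t).
  { apply @ex_RInt_continuous. rewrite Rmin_left, Rmax_right by lra. intros r Hr.
    apply (continuous_comp (fun r => k (x r) * u r) Rabs); [apply cl, Hr | apply continuous_Rabs]. }
  assert (E2 : ex_RInt (fun r => Rabs (k (y r) * v r)) s t).
  { apply @ex_RInt_continuous. rewrite Rmin_left, Rmax_right by lra. intros r Hr.
    apply (continuous_comp (fun r => k (y r) * v r) Rabs); [apply cl, Hr | apply continuous_Rabs]. }
  assert (IV : is_RInt V s t (A * (RInt (fun r => Rabs (k (x r) * u r)) s t
                                   + RInt (fun r => Rabs (k (y r) * v r)) s t))).
  { apply (is_RInt_scal (fun r => Rabs (k (x r) * u r) + Rabs (k (y r) * v r)) s t A).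
    apply (is_RInt_plus (fun r => Rabs (k (x r) * u r)) (fun r => Rabs (k (y r) * v r)));
    now apply @RInt_correct. }
  assert (le : Rabs (psi t - psi s) <= A * (RInt (fun r => Rabs (k (x r) * u r)) s t
                                   + RInt (fun r => Rabs (k (y r) * v r)) s t)).
  { apply (norm_RInt_le dpsi V s t); try assumption. intros r Hr.
    change (Rabs (dpsi r) <= V r).
    pose proof (geo_unit _ _ _ _ _ _ _ (geo r Hr)) as U.
    pose proof (Rle_0_sqr (rise p (x r) (y r) (u r) (v r))). unfold Rsqr in *.
    assert (Hu : Rabs (u r) <= 1) by (apply Rabs_le; nra).
    assert (Hv : Rabs (v r) <= 1) by (apply Rabs_le; nra).
    pose proof (area_factor_ge1 p (x r) (y r)) as HW.
    assert (HN : Rabs (N r) <= A * area_factor p (x r) (y r)).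
    { apply Rle_trans with (A * sqrt (area_factor p (x r) (y r))).
      - rewrite <- sqrt_Rsqr_abs. unfold A. rewrite <- sqrt_mult by nra.
        apply sqrt_le_1_alt. unfold N, area_factor, Rsqr.
        (* The Cauchy-Schwarz inequality, in the form of Lagrange's identity. *)
        pose proof (pow2_ge_0 (d1 * p (y r) + d2 * p (x r))).
        pose proof (pow2_ge_0 (d1 + d3 * p (x r))).
        pose proof (pow2_ge_0 (d2 - d3 * p (y r))). lra.
      - apply Rmult_le_compat_l; [exact HA|].
        rewrite <- (sqrt_Rsqr (area_factor p (x r) (y r))) at 2 by lra.
        apply sqrt_le_1_alt. unfold Rsqr. nra. }
    assert (HQ : Rabs (k (x r) * u r * u r - k (y r) * v r * v r)
                 <= Rabs (k (x r) * u r) + Rabs (k (y r) * v r)).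
    { refine (Rle_trans _ _ _ (Rabs_triang _ _) _). rewrite Rabs_Ropp.
      rewrite (Rabs_mult (k (x r) * u r)), (Rabs_mult (k (y r) * v r)).
      pose proof (Rabs_pos (k (x r) * u r)). pose proof (Rabs_pos (k (y r) * v r)).
      apply Rplus_le_compat.
      - rewrite <- (Rmult_1_r (Rabs (k (x r) * u r))) at 2. now apply Rmult_le_compat_l.
      - rewrite <- (Rmult_1_r (Rabs (k (y r) * v r))) at 2. now apply Rmult_le_compat_l. }
    unfold dpsi, bend, bending, V, Rdiv.
    rewrite Rabs_mult, Rabs_mult, Rabs_inv, (Rabs_pos_eq (area_factor _ _ _)) by lra.
    set (Wr := area_factor p (x r) (y r)) in *.
    apply Rle_trans with (A * Wr * ((Rabs (k (x r) * u r) + Rabs (k (y r) * v r)) * / Wr)).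
    - apply Rmult_le_compat; [apply Rabs_pos| |exact HN|].
      + apply Rmult_le_pos; [apply Rabs_pos|]. left. apply Rinv_0_lt_compat. lra.
      + apply Rmult_le_compat_r; [|exact HQ]. left. apply Rinv_0_lt_compat. lra.
    - right. field. lra. }
  assert (Vx : RInt (fun r => Rabs (k (x r) * u r)) s t <= 2 * (b - a)).
  { apply (slope_variation x u climb_x'); try assumption.
    - intros r Hr. apply (geo_x _ _ _ _ _ _ _ (geo r Hr)).
    - intros r Hr. apply (continuous_along r Hr).
    - intros r Hr. now apply climb_x_derive, geo.
    - apply climb_x_convex. }
  assert (Vy : RInt (fun r => Rabs (k (y r) * v r)) s t <= 2 * (b - a)).
  { apply (slope_variation y v climb_y'); try assumption.
    - intros r Hr. apply (geo_y _ _ _ _ _ _ _ (geo r Hr)).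
    - intros r Hr. apply (continuous_along r Hr).
    - intros r Hr. now apply climb_y_derive, geo.
    - apply climb_y_convex. }
  assert (P0 : psi t - psi s = A * A) by (rewrite HA2; unfold psi, d1, d2, d3; ring).
  rewrite P0, Rabs_pos_eq in le by nra.
  assert (le2 : A * A <= A * (4 * (b - a))).
  { apply Rle_trans with (1 := le). apply Rmult_le_compat_l; lra. }
  rewrite <- HA2.
  destruct HA as [Hpos|E]; [|pose proof (pow2_ge_0 (4 * (b - a))); rewrite <- E; lra].
  assert (A <= 4 * (b - a)) by (apply Rmult_le_reg_l with A; lra).
  rewrite <- Rsqr_pow2. apply Rmult_le_compat; lra.
Qed.

Lemma tangent_dot : turning_constant a b <= u s * u t + v s * v t + rise_along s * rise_along t.
Proof.
  unfold turning_constant. pose proof tangent_turning.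
  pose proof (geo_unit _ _ _ _ _ _ _ (geo s ltac:(lra))) as U1.
  pose proof (geo_unit _ _ _ _ _ _ _ (geo t ltac:(lra))) as U2.
  change (rise p (x s) (y s) (u s) (v s)) with (rise_along s) in U1.
  change (rise p (x t) (y t) (u t) (v t)) with (rise_along t) in U2.
  nra.
Qed.

End Curve.

End Turning.

(** * Chords of geodesics *)

Section Lines.

Context (g p k : R -> R) (a b G : R)
  (g_derive : forall t, is_derive g t (p t))
  (p_derive : forall t, is_derive p t (k t))
  (k_continuous : forall t, continuous k t)
  (k_pos : forall t, 0 < k t)
  (p_bounds : forall t, a <= p t <= b)
  (g_lipschitz : forall s t, Rabs (g s - g t) <= G * Rabs (s - t))
  (G_nonneg : 0 <= G).

Notation delta := (turning_constant a b).

Context (x y u v : R -> R).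

Definition height (t : R) : R := g (x t) - g (y t).

Lemma height_derive (t : R) : geodesic_at p k x y u v t ->
  is_derive height t (rise_along p x y u v t).
Proof.
  intros H. apply is_derive_Rminus; apply is_derive_Rcomp; try apply g_derive.
  - apply (geo_x _ _ _ _ _ _ _ H).
  - apply (geo_y _ _ _ _ _ _ _ H).
Qed.

Lemma tangent_chord (s t0 t : R) : s <= t0 -> t0 <= t ->
  (forall r, s <= r <= t -> geodesic_at p k x y u v r) ->
  delta * (t - t0) <=
    u s * (x t - x t0) + v s * (y t - y t0) + rise_along p x y u v s * (height t - height t0).
Proof.
  intros H1 H2 geo.
  pose (f := fun r => (u s * x r + v s * y r + rise_along p x y u v s * height r) - delta * r).
  assert (M : f t0 <= f t).
  { apply (derive_nonneg_le f (fun r => (u s * u r + v s * v r + rise_along p x y u v s * rise_along p x y u v r)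
                                        - delta * 1)); [exact H2| |].
    - intros r Hr. assert (Gr := geo r ltac:(lra)). unfold f.
      apply is_derive_Rminus; [apply is_derive_Rplus; [apply is_derive_Rplus|]|]; apply is_derive_Rscal.
      + apply (geo_x _ _ _ _ _ _ _ Gr).
      + apply (geo_y _ _ _ _ _ _ _ Gr).
      + now apply height_derive.
      + apply @is_derive_id.
    - intros r Hr.
      assert (delta <= u s * u r + v s * v r + rise_along p x y u v s * rise_along p x y u v r); [|lra].
      apply (tangent_dot p k a b); try assumption; [lra|].
      intros q Hq; apply geo; lra. }
  unfold f in M. lra.
Qed.

Lemma chord_chord (s t0 t : R) : s <= t0 -> t0 <= t ->
  (forall r, s <= r <= t -> geodesic_at p k x y u v r) ->
  delta * (t - t0) * (t0 - s) <=
    (x t0 - x s) * (x t - x t0) + (y t0 - y s) * (y t - y t0)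
    + (height t0 - height s) * (height t - height t0).
Proof.
  intros H1 H2 geo.
  pose (X := x t - x t0). pose (Y := y t - y t0). pose (Z := height t - height t0).
  pose (c := delta * (t - t0)).
  pose (f := fun r => (X * x r + Y * y r + Z * height r) - c * r).
  assert (M : f s <= f t0).
  { apply (derive_nonneg_le f (fun r => (X * u r + Y * v r + Z * rise_along p x y u v r) - c * 1)); [exact H1| |].
    - intros r Hr. assert (Gr := geo r ltac:(lra)). unfold f.
      apply is_derive_Rminus; [apply is_derive_Rplus; [apply is_derive_Rplus|]|]; apply is_derive_Rscal.
      + apply (geo_x _ _ _ _ _ _ _ Gr).
      + apply (geo_y _ _ _ _ _ _ _ Gr).
      + now apply height_derive.
      + apply @is_derive_id.
    - intros r Hr.
      pose proof (tangent_chord r t0 t ltac:(lra) H2 ltac:(intros; apply geo; lra)) as T.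
      unfold c, X, Y, Z. lra. }
  unfold f, X, Y, Z, c in M |- *. lra.
Qed.

Lemma height_le (r d : R) : Rabs (x r - y r) <= d -> Rabs (height r) <= G * d.
Proof.
  intros H. unfold height. apply Rle_trans with (1 := g_lipschitz _ _).
  now apply Rmult_le_compat_l.
Qed.

(** The hypothesis says that the past of the line stays near the ray [S |-> e c (S, S)].  On it the
    heights stay bounded, so the chord from time [- S] to time [0] is [- e c S (1, 1, 0)] up to a
    bounded error.  Divide the inequality [chord_chord] by [S] and let [S] grow. *)
Lemma line_from_diagonal_end (e c D : R) :
  (forall r, geodesic_at p k x y u v r) ->
  (forall S, 0 <= S -> Rabs (x (- S) - e * (c * S)) <= D /\ Rabs (y (- S) - e * (c * S)) <= D) ->
  forall t, 0 <= t ->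
  delta * t + e * c * ((x t - x 0) + (y t - y 0)) <= 0.
Proof.
  intros geo near t Ht.
  pose (X := x t - x 0). pose (Y := y t - y 0). pose (Z := height t - height 0).
  pose (M := (Rabs (x 0) + D) * Rabs X + (Rabs (y 0) + D) * Rabs Y
             + (Rabs (height 0) + G * (D + D)) * Rabs Z).
  apply coefficient_nonpos with M. intros S HS.
  destruct (near S HS) as [Nx Ny].
  pose proof (chord_chord (- S) 0 t ltac:(lra) Ht ltac:(intros; apply geo)) as Ch.
  fold X Y Z in Ch.
  assert (Nz : Rabs (height (- S)) <= G * (D + D)).
  { apply height_le.
    replace (x (- S) - y (- S)) with ((x (- S) - e * (c * S)) + - (y (- S) - e * (c * S))) by ring.
    refine (Rle_trans _ _ _ (Rabs_triang _ _) _). rewrite Rabs_Ropp. lra. }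
  assert (prod : forall q r m d, Rabs r <= d -> (q - r) * m <= (Rabs q + d) * Rabs m).
  { intros q r m d Hr. refine (Rle_trans _ _ _ (Rle_abs _) _). rewrite Rabs_mult.
    apply Rmult_le_compat_r; [apply Rabs_pos|].
    unfold Rminus. refine (Rle_trans _ _ _ (Rabs_triang _ _) _). rewrite Rabs_Ropp. lra. }
  pose proof (prod (x 0) _ X D Nx) as P1.
  pose proof (prod (y 0) _ Y D Ny) as P2.
  pose proof (prod (height 0) _ Z _ Nz) as P3.
  unfold M. fold X Y. lra.
Qed.

End Lines.

(** * Existence of geodesic rays *)

Inductive phase : Set := Px | Py | Vx | Vy.

(** The truncated system replaces a velocity [r] by [clip r * damp r].  Both factors are bounded
    and Lipschitz, and so is [r * (clip r * damp r) = clip r ^ 2], the combination on which the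
    conservation of energy depends.  With [clip r] alone it would be [r * clip r], which is
    unbounded. *)
Definition clip (r : R) : R := Rmax (-1) (Rmin 1 r).
Definition damp (r : R) : R := / Rmax 1 (Rabs r).

Lemma clip_bound (r : R) : Rabs (clip r) <= 1.
Proof.
  unfold clip, Rmax, Rmin. apply Rabs_le.
  destruct (Rle_dec 1 r), (Rle_dec (-1) _); lra.
Qed.

Lemma clip_lipschitz (r s : R) : Rabs (clip r - clip s) <= Rabs (r - s).
Proof. eapply Rle_trans; [apply Rmax_contraction | apply Rmin_contraction]. Qed.

Lemma inv_ge1_bound (A : R) : 1 <= A -> 0 < / A <= 1.
Proof.
  intros H. split; [apply Rinv_0_lt_compat; lra|].
  apply Rmult_le_reg_l with A; [lra|]. rewrite Rinv_r; lra.
Qed.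

Lemma damp_bound (r : R) : 0 < damp r <= 1.
Proof. apply inv_ge1_bound, Rmax_l. Qed.

Lemma inv_lipschitz (A B : R) : 1 <= A -> 1 <= B -> Rabs (/ A - / B) <= Rabs (A - B).
Proof.
  intros HA HB. replace (/ A - / B) with ((B - A) * (/ A * / B)) by (field; lra).
  pose proof (inv_ge1_bound A HA). pose proof (inv_ge1_bound B HB).
  rewrite Rabs_mult, Rabs_minus_sym, (Rabs_pos_eq (/ A * / B)) by nra.
  rewrite <- (Rmult_1_r (Rabs (A - B))) at 2.
  apply Rmult_le_compat_l; [apply Rabs_pos | nra].
Qed.

Lemma damp_lipschitz (r s : R) : Rabs (damp r - damp s) <= Rabs (r - s).
Proof.
  unfold damp. eapply Rle_trans; [apply inv_lipschitz; apply Rmax_l|].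
  eapply Rle_trans; [apply Rmax_contraction | apply Rabs_triang_inv2].
Qed.

Lemma clip_small (r : R) : Rabs r <= 1 -> clip r = r.
Proof.
  intros H. apply Rabs_le_between in H. unfold clip.
  rewrite Rmin_right, Rmax_right; lra.
Qed.

Lemma damp_small (r : R) : Rabs r <= 1 -> damp r = 1.
Proof. intros H. unfold damp. rewrite Rmax_left by exact H. apply Rinv_1. Qed.

Lemma clip_damp (r : R) : r * damp r = clip r.
Proof.
  destruct (Rle_dec (Rabs r) 1) as [H|H].
  - rewrite clip_small, damp_small by exact H. ring.
  - unfold damp. rewrite Rmax_right by lra. unfold clip, Rabs in *.
    destruct (Rcase_abs r).
    + rewrite Rmin_right, Rmax_left by lra. field. lra.
    + rewrite Rmin_left, Rmax_right by lra. field. lra.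
Qed.

(** Unlike Lipschitz functions alone, these are closed under products. *)
Definition bounded_lipschitz {J : Type} (S : (J -> R) -> Prop) (f : (J -> R) -> R) : Prop :=
  exists C L, 0 <= C /\ 0 <= L /\ (forall z, S z -> Rabs (f z) <= C) /\
  forall z z', S z -> S z' -> forall e, (forall j, Rabs (z j - z' j) <= e) ->
  Rabs (f z - f z') <= L * e.

Section BoundedLipschitz.

Context {J : Type} (S : (J -> R) -> Prop).

Lemma bl_mult (f h : (J -> R) -> R) :
  bounded_lipschitz S f -> bounded_lipschitz S h -> bounded_lipschitz S (fun z => f z * h z).
Proof.
  intros [C [L [C0 [L0 [Bf Lf]]]]] [C' [L' [C0' [L0' [Bh Lh]]]]].
  exists (C * C'), (L * C' + C * L').
  split; [nra|]. split; [nra|]. split.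
  - intros z Hz. rewrite Rabs_mult. apply Rmult_le_compat; auto using Rabs_pos.
  - intros z z' Hz Hz' e He.
    replace (f z * h z - f z' * h z') with ((f z - f z') * h z + f z' * (h z - h z')) by ring.
    refine (Rle_trans _ _ _ (Rabs_triang _ _) _). rewrite 2 Rabs_mult, Rmult_plus_distr_r.
    apply Rplus_le_compat.
    + replace (L * C' * e) with (L * e * C') by ring.
      apply Rmult_le_compat; auto using Rabs_pos.
    + rewrite Rmult_assoc. apply Rmult_le_compat; auto using Rabs_pos.
Qed.

Lemma bl_plus (f h : (J -> R) -> R) :
  bounded_lipschitz S f -> bounded_lipschitz S h -> bounded_lipschitz S (fun z => f z + h z).
Proof.
  intros [C [L [C0 [L0 [Bf Lf]]]]] [C' [L' [C0' [L0' [Bh Lh]]]]].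
  exists (C + C'), (L + L').
  split; [lra|]. split; [lra|]. split.
  - intros z Hz. refine (Rle_trans _ _ _ (Rabs_triang _ _) _). apply Rplus_le_compat; auto.
  - intros z z' Hz Hz' e He.
    replace (f z + h z - (f z' + h z')) with ((f z - f z') + (h z - h z')) by ring.
    refine (Rle_trans _ _ _ (Rabs_triang _ _) _). rewrite Rmult_plus_distr_r.
    apply Rplus_le_compat; auto.
Qed.

Lemma bl_const (c : R) : bounded_lipschitz S (fun _ => c).
Proof.
  exists (Rabs c), 0. split; [apply Rabs_pos|]. split; [lra|]. split.
  - intros; apply Rle_refl.
  - intros z z' _ _ e _. rewrite Rminus_diag, Rabs_R0. lra.
Qed.

Lemma bl_inv (f : (J -> R) -> R) : (forall z, 1 <= f z) ->
  bounded_lipschitz S f -> bounded_lipschitz S (fun z => / f z).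
Proof.
  intros H1 [C [L [C0 [L0 [Bf Lf]]]]]. exists 1, L.
  split; [lra|]. split; [lra|]. split.
  - intros z _. destruct (inv_ge1_bound (f z) (H1 z)). rewrite Rabs_pos_eq; lra.
  - intros z z' Hz Hz' e He. eapply Rle_trans; [apply inv_lipschitz; apply H1|]. auto.
Qed.

Lemma bl_contraction (f : R -> R) (j : J) :
  (forall r, Rabs (f r) <= 1) -> (forall r s, Rabs (f r - f s) <= Rabs (r - s)) ->
  bounded_lipschitz S (fun z => f (z j)).
Proof.
  intros Bf Lf. exists 1, 1. split; [lra|]. split; [lra|]. split; [auto|].
  intros z z' _ _ e He. rewrite Rmult_1_l. eapply Rle_trans; [apply Lf | apply He].
Qed.

Lemma bl_C1 (f df : R -> R) (j : J) (M : R) :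
  (forall t, is_derive f t (df t)) -> (forall t, continuous df t) ->
  (forall z, S z -> Rabs (z j) <= M) -> bounded_lipschitz S (fun z => f (z j)).
Proof.
  intros HD HC HM.
  destruct (Rle_dec 0 M) as [M0|M0].
  2:{ exists 0, 0. assert (no : forall z, ~ S z).
      { intros z Hz. specialize (HM z Hz). pose proof (Rabs_pos (z j)). lra. }
      split; [lra|]. split; [lra|]. split.
      - intros z Hz. destruct (no z Hz).
      - intros z z' Hz. destruct (no z Hz). }
  destruct (continuity_ab_maj (fun t => Rabs (df t)) (- M) M) as [m [Hm _]]; [lra| |].
  { intros c _. apply continuous_continuity_pt.
    apply (continuous_comp df Rabs); [apply HC | apply continuous_Rabs]. }
  set (L := Rabs (df m)) in *.
  assert (L0 : 0 <= L) by apply Rabs_pos.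
  assert (Lip : forall s t, Rabs s <= M -> Rabs t <= M -> Rabs (f s - f t) <= L * Rabs (s - t)).
  { intros s t Hs Ht. apply Rabs_le_between in Hs, Ht.
    destruct (MVT_gen f t s df) as [c [Hc E]].
    - intros; apply HD.
    - intros r _. eapply continuous_continuity_pt, is_derive_continuous, HD.
    - rewrite E, Rabs_mult. apply Rmult_le_compat_r; [apply Rabs_pos|]. apply Hm.
      revert Hc; unfold Rmin, Rmax; destruct (Rle_dec t s); lra. }
  exists (Rabs (f 0) + L * M), L.
  split; [pose proof (Rabs_pos (f 0)); nra|]. split; [exact L0|]. split.
  - intros z Hz. specialize (HM z Hz).
    replace (f (z j)) with (f 0 + (f (z j) - f 0)) by ring.
    refine (Rle_trans _ _ _ (Rabs_triang _ _) _). apply Rplus_le_compat_l.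
    refine (Rle_trans _ _ _ (Lip _ _ HM _) _); [rewrite Rabs_R0; exact M0|].
    rewrite Rminus_0_r. now apply Rmult_le_compat_l.
  - intros z z' Hz Hz' e He. refine (Rle_trans _ _ _ (Lip _ _ (HM z Hz) (HM z' Hz')) _).
    now apply Rmult_le_compat_l.
Qed.

End BoundedLipschitz.

Section Existence.

Context (p k dk : R -> R)
  (p_derive : forall t, is_derive p t (k t))
  (k_derive : forall t, is_derive k t (dk t))
  (dk_continuous : forall t, continuous dk t).

(** This is [bending] with [u ^ 2] and [v ^ 2] clipped.  The clipped squares are the
    products of the damped velocities with the true ones. *)
Definition tame_bending (z : phase -> R) : R :=
  (k (z Px) * (clip (z Vx) * clip (z Vx)) + - (1) * (k (z Py) * (clip (z Vy) * clip (z Vy))))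
  * / area_factor p (z Px) (z Py).

Definition tame_field (z : phase -> R) (j : phase) : R :=
  match j with
  | Px => clip (z Vx) * damp (z Vx)
  | Py => clip (z Vy) * damp (z Vy)
  | Vx => - (1) * p (z Px) * tame_bending z
  | Vy => p (z Py) * tame_bending z
  end.

Lemma k_cont (t : R) : continuous k t.
Proof. eapply is_derive_continuous, k_derive. Qed.

Lemma p_cont (t : R) : continuous p t.
Proof. eapply is_derive_continuous, p_derive. Qed.

Lemma tame_field_continuous (Z : R -> phase -> R) :
  (forall t j, continuous (fun s => Z s j) t) ->
  forall t j, continuous (fun s => tame_field (Z s) j) t.
Proof.
  intros HZ.
  assert (mul : forall f h t, continuous f t -> continuous h t -> continuous (fun s : R => f s * h s : R) t)
    by (intros f h t; apply (continuous_mult f h)).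
  assert (pls : forall f h t, continuous f t -> continuous h t -> continuous (fun s : R => f s + h s : R) t)
    by (intros f h t; apply (continuous_plus f h)).
  assert (cst : forall (c t : R), continuous (fun _ : R => c) t) by (intros; apply continuous_const).
  assert (clp : forall j t, continuous (fun s => clip (Z s j)) t).
  { intros j t. apply (continuous_comp (fun s => Z s j) clip); [apply HZ|].
    apply lipschitz_continuous, clip_lipschitz. }
  assert (dmp : forall j t, continuous (fun s => damp (Z s j)) t).
  { intros j t. apply (continuous_comp (fun s => Z s j) damp); [apply HZ|].
    apply lipschitz_continuous, damp_lipschitz. }
  assert (cp : forall j t, continuous (fun s => p (Z s j)) t).
  { intros j t. apply (continuous_comp (fun s => Z s j) p); [apply HZ | apply p_cont]. }
  assert (ck : forall j t, continuous (fun s => k (Z s j)) t).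
  { intros j t. apply (continuous_comp (fun s => Z s j) k); [apply HZ | apply k_cont]. }
  assert (cb : forall t, continuous (fun s => tame_bending (Z s)) t).
  { intros t. apply mul.
    - apply pls; [|apply mul; [apply cst|]]; (apply mul; [apply ck | apply mul; apply clp]).
    - apply continuous_Rinv_comp.
      + apply pls; [apply pls; [apply cst|]|]; apply mul; apply cp.
      + pose proof (area_factor_ge1 p (Z t Px) (Z t Py)). lra. }
  intros t [ | | | ]; simpl.
  - apply mul; auto.
  - apply mul; auto.
  - apply mul; [|apply cb]. apply mul; auto.
  - apply mul; auto.
Qed.

Lemma tame_field_bl (M : R) (j : phase) :
  bounded_lipschitz (fun z => Rabs (z Px) <= M /\ Rabs (z Py) <= M) (fun z => tame_field z j).
Proof.
  set (S := fun z : phase -> R => Rabs (z Px) <= M /\ Rabs (z Py) <= M).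
  assert (clp : forall j, bounded_lipschitz S (fun z => clip (z j))).
  { intros i. apply bl_contraction; [apply clip_bound | apply clip_lipschitz]. }
  assert (dmp : forall j, bounded_lipschitz S (fun z => damp (z j))).
  { intros i. apply bl_contraction; [|apply damp_lipschitz].
    intros r. destruct (damp_bound r). rewrite Rabs_pos_eq; lra. }
  assert (px : bounded_lipschitz S (fun z => p (z Px))).
  { apply (bl_C1 S p k Px M p_derive k_cont). now intros z []. }
  assert (py : bounded_lipschitz S (fun z => p (z Py))).
  { apply (bl_C1 S p k Py M p_derive k_cont). now intros z []. }
  assert (kx : bounded_lipschitz S (fun z => k (z Px))).
  { apply (bl_C1 S k dk Px M k_derive dk_continuous). now intros z []. }
  assert (ky : bounded_lipschitz S (fun z => k (z Py))).
  { apply (bl_C1 S k dk Py M k_derive dk_continuous). now intros z []. }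
  assert (tb : bounded_lipschitz S tame_bending).
  { apply (bl_mult S (fun z => _) (fun z => / area_factor p (z Px) (z Py))).
    - apply (bl_plus S (fun z => _) (fun z => _)).
      + apply bl_mult; [exact kx|]. now apply bl_mult.
      + apply bl_mult; [apply bl_const|]. apply bl_mult; [exact ky|]. now apply bl_mult.
    - apply bl_inv.
      + intros z. apply area_factor_ge1.
      + apply bl_plus; [apply bl_plus; [apply bl_const|]|]; now apply bl_mult. }
  destruct j; simpl.
  - now apply bl_mult.
  - now apply bl_mult.
  - apply bl_mult; [|exact tb]. apply bl_mult; [apply bl_const | exact px].
  - now apply bl_mult.
Qed.

Lemma tame_field_uniform (M : R) : exists C L, 1 <= C /\ 0 <= L /\
  (forall z, Rabs (z Px) <= M /\ Rabs (z Py) <= M -> forall j, Rabs (tame_field z j) <= C) /\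
  (forall z z', Rabs (z Px) <= M /\ Rabs (z Py) <= M -> Rabs (z' Px) <= M /\ Rabs (z' Py) <= M ->
   forall e, (forall j, Rabs (z j - z' j) <= e) ->
   forall j, Rabs (tame_field z j - tame_field z' j) <= L * e).
Proof.
  destruct (tame_field_bl M Px) as [C1 [L1 [c1 [l1 [B1 E1]]]]].
  destruct (tame_field_bl M Py) as [C2 [L2 [c2 [l2 [B2 E2]]]]].
  destruct (tame_field_bl M Vx) as [C3 [L3 [c3 [l3 [B3 E3]]]]].
  destruct (tame_field_bl M Vy) as [C4 [L4 [c4 [l4 [B4 E4]]]]].
  exists (1 + C1 + C2 + C3 + C4), (L1 + L2 + L3 + L4).
  split; [lra|]. split; [lra|]. split.
  - intros z Hz j. destruct j;
    [specialize (B1 z Hz) | specialize (B2 z Hz) | specialize (B3 z Hz) | specialize (B4 z Hz)]; lra.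
  - intros z z' Hz Hz' e He j.
    assert (0 <= e) by (apply Rle_trans with (2 := He j); apply Rabs_pos).
    specialize (E1 z z' Hz Hz' e He). specialize (E2 z z' Hz Hz' e He).
    specialize (E3 z z' Hz Hz' e He). specialize (E4 z z' Hz Hz' e He).
    destruct j; nra.
Qed.

Lemma tame_velocity_bound (z : phase -> R) (i : phase) :
  Rabs (clip (z i) * damp (z i)) <= 1.
Proof.
  rewrite Rabs_mult. destruct (damp_bound (z i)).
  rewrite (Rabs_pos_eq (damp (z i))) by lra.
  pose proof (clip_bound (z i)). pose proof (Rabs_pos (clip (z i))). nra.
Qed.

Lemma tame_solution (z0 : phase -> R) : exists Z : R -> phase -> R,
  (forall j, Z 0 j = z0 j) /\
  forall t, 0 <= t -> forall j, is_derive (fun s => Z s j) t (tame_field (Z t) j).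
Proof.
  apply global_solution; [exact tame_field_continuous|].
  intros T HT.
  destruct (tame_field_uniform (Rabs (z0 Px) + Rabs (z0 Py) + T)) as [C [L [HC [HL [Bd Lp]]]]].
  set (r := fun j => match j with Px | Py => T | _ => T * C end).
  assert (sub : forall z, box z0 r z ->
    Rabs (z Px) <= Rabs (z0 Px) + Rabs (z0 Py) + T /\ Rabs (z Py) <= Rabs (z0 Px) + Rabs (z0 Py) + T).
  { intros z Hz. pose proof (Hz Px) as H1. pose proof (Hz Py) as H2. simpl in H1, H2.
    pose proof (Rabs_triang (z0 Px) (z Px - z0 Px)) as T1.
    pose proof (Rabs_triang (z0 Py) (z Py - z0 Py)) as T2.
    replace (z0 Px + (z Px - z0 Px)) with (z Px) in T1 by ring.
    replace (z0 Py + (z Py - z0 Py)) with (z Py) in T2 by ring.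
    pose proof (Rabs_pos (z0 Px)). pose proof (Rabs_pos (z0 Py)). lra. }
  exists r, C, L. split; [|split; [exact HL|split]].
  - intros j; destruct j; simpl; nra.
  - intros z Hz j. split; [now apply Bd, sub|].
    pose proof (Bd z (sub z Hz) j) as H. destruct j; simpl.
    + pose proof (tame_velocity_bound z Vx). nra.
    + pose proof (tame_velocity_bound z Vy). nra.
    + simpl in H. nra.
    + simpl in H. nra.
  - intros z z' Hz Hz' e He j. apply Lp; auto.
Qed.

(** The truncated system conserves the energy exactly.  Starting at unit speed, both components
    of the velocity thus remain in [[-1, 1]], where the system is the geodesic equation. *)
Theorem unit_geodesic_exists (x0 y0 u0 v0 : R) :
  u0 * u0 + v0 * v0 + rise p x0 y0 u0 v0 * rise p x0 y0 u0 v0 = 1 ->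
  exists x y u v : R -> R,
    x 0 = x0 /\ y 0 = y0 /\ u 0 = u0 /\ v 0 = v0 /\
    forall t, 0 <= t -> geodesic_at p k x y u v t.
Proof.
  intros unit0.
  destruct (tame_solution (fun j => match j with Px => x0 | Py => y0 | Vx => u0 | Vy => v0 end))
    as [Z [init sol]].
  set (x := fun t => Z t Px). set (y := fun t => Z t Py).
  set (u := fun t => Z t Vx). set (v := fun t => Z t Vy).
  set (en := fun t => u t * u t + v t * v t
                      + rise p (x t) (y t) (u t) (v t) * rise p (x t) (y t) (u t) (v t)).
  assert (den : forall t, 0 <= t -> is_derive en t 0).
  { intros t Ht.
    pose proof (sol t Ht Px) as Dx. pose proof (sol t Ht Py) as Dy.
    pose proof (sol t Ht Vx) as Du. pose proof (sol t Ht Vy) as Dv.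
    simpl in Dx, Dy, Du, Dv.
    change (is_derive x t (clip (u t) * damp (u t))) in Dx.
    change (is_derive y t (clip (v t) * damp (v t))) in Dy.
    change (is_derive u t (- (1) * p (x t) * tame_bending (Z t))) in Du.
    change (is_derive v t (p (y t) * tame_bending (Z t))) in Dv.
    assert (EB : tame_bending (Z t) * area_factor p (x t) (y t) =
      k (x t) * (clip (u t) * damp (u t)) * u t - k (y t) * (clip (v t) * damp (v t)) * v t).
    { unfold tame_bending. fold (x t) (y t) (u t) (v t).
      pose proof (area_factor_ge1 p (x t) (y t)).
      rewrite Rmult_assoc, Rinv_l, Rmult_1_r by lra.
      rewrite <- (clip_damp (u t)) at 2. rewrite <- (clip_damp (v t)) at 2. ring. }
    assert (Dr : is_derive (fun t => rise p (x t) (y t) (u t) (v t)) t (tame_bending (Z t))).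
    { eapply is_derive_eq.
      - apply is_derive_Rminus; apply is_derive_Rmult;
        try (apply is_derive_Rcomp; [apply p_derive|]); eassumption.
      - unfold area_factor in EB. lra. }
    eapply is_derive_eq.
    - apply is_derive_Rplus; [apply is_derive_Rplus|]; apply is_derive_Rmult; eassumption.
    - unfold rise. ring. }
  assert (E : forall t, 0 <= t -> en t = 1).
  { intros t Ht. rewrite <- unit0.
    transitivity (en 0); [symmetry; apply (derive_zero_eq en 0 t Ht)|].
    2:{ unfold en, x, y, u, v. rewrite !init. reflexivity. }
    intros r Hr. apply den. lra. }
  exists x, y, u, v.
  split; [apply init|]. split; [apply init|]. split; [apply init|]. split; [apply init|].
  intros t Ht. specialize (E t Ht).
  pose proof (sol t Ht) as D.
  assert (Hu : Rabs (u t) <= 1).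
  { pose proof (Rle_0_sqr (rise p (x t) (y t) (u t) (v t))). unfold Rsqr, en in *. apply Rabs_le. nra. }
  assert (Hv : Rabs (v t) <= 1).
  { pose proof (Rle_0_sqr (rise p (x t) (y t) (u t) (v t))). unfold Rsqr, en in *. apply Rabs_le. nra. }
  assert (EB : tame_bending (Z t) = bending p k (x t) (y t) (u t) (v t)).
  { unfold tame_bending, bending. fold (x t) (y t) (u t) (v t).
    rewrite (clip_small (u t) Hu), (clip_small (v t) Hv). unfold Rdiv. f_equal. ring. }
  constructor; [eapply is_derive_eq; [apply D|]..|exact E]; simpl; fold (x t) (y t) (u t) (v t).
  - rewrite clip_small, damp_small by exact Hu. ring.
  - rewrite clip_small, damp_small by exact Hv. ring.
  - rewrite EB. ring.
  - rewrite EB. ring.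
Qed.

End Existence.

(** * The induced metric and its curvature *)

Section Smooth.

Lemma Ck_S (n : nat) (u : R * R -> R) : Ck (S n) u -> Ck n u.
Proof.
  revert u; induction n as [|n IH]; intros u [Hc Hp]; [exact Hc|].
  split; [exact Hc|]. intros i. destruct (Hp i) as [He Hk]. split; [exact He | now apply IH].
Qed.

Lemma Ck_plus (n : nat) (u u' : R * R -> R) :
  Ck n u -> Ck n u' -> Ck n (fun q => u q + u' q).
Proof.
  revert u u'; induction n as [|n IH]; intros u u' Hu Hu'.
  - intros q. apply (continuous_plus u u'); [apply Hu | apply Hu'].
  - split.
    + intros q. apply (continuous_plus u u'); [apply Hu | apply Hu'].
    + intros i. destruct Hu as [_ Hu]. destruct Hu' as [_ Hu'].
      destruct (Hu i) as [E K], (Hu' i) as [E' K']. split.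
      * intros q. specialize (E q). specialize (E' q). destruct i; exact (ex_derive_plus _ _ _ E E').
      * replace (partial i (fun q => u q + u' q)) with (fun q => partial i u q + partial i u' q).
        -- now apply IH.
        -- apply functional_extensionality. intros q. specialize (E q). specialize (E' q).
           symmetry. destruct i; exact (Derive_plus _ _ _ E E').
Qed.

Lemma Ck_mult (n : nat) (u u' : R * R -> R) :
  Ck n u -> Ck n u' -> Ck n (fun q => u q * u' q).
Proof.
  revert u u'; induction n as [|n IH]; intros u u' Hu Hu'.
  - intros q. apply (continuous_mult u u'); [apply Hu | apply Hu'].
  - split.
    + intros q. apply (continuous_mult u u'); [apply Hu | apply Hu'].
    + intros i. pose proof (Ck_S _ _ Hu) as Lu. pose proof (Ck_S _ _ Hu') as Lu'.
      destruct Hu as [_ Hu]. destruct Hu' as [_ Hu'].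
      destruct (Hu i) as [E K], (Hu' i) as [E' K']. split.
      * intros q. specialize (E q). specialize (E' q). destruct i; exact (ex_derive_mult _ _ _ E E').
      * replace (partial i (fun q => u q * u' q))
          with (fun q => partial i u q * u' q + u q * partial i u' q).
        -- apply Ck_plus; now apply IH.
        -- apply functional_extensionality. intros [q1 q2].
           specialize (E (q1, q2)). specialize (E' (q1, q2)).
           symmetry. destruct i; exact (Derive_mult _ _ _ E E').
Qed.

Lemma Ck_const (n : nat) (c : R) : Ck n (fun _ => c).
Proof.
  revert c; induction n as [|n IH]; intros c.
  - intros q. apply continuous_const.
  - split; [intros q; apply continuous_const|]. intros i. split.
    + intros q. destruct i; exact (ex_derive_const (K := R_AbsRing) (V := R_NormedModule) c _).
    + replace (partial i (fun _ => c)) with (fun _ : R * R => 0); [apply IH|].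
      apply functional_extensionality. intros q. symmetry. destruct i; exact (Derive_const c _).
Qed.

Lemma Ck_coord (n m : nat) (g : R -> R) (j : idx) : smooth_line g ->
  Ck n (fun q => Derive_n g m (coord j q)).
Proof.
  intros Hg. revert m; induction n as [|n IH]; intros m.
  - intros q. apply (continuous_comp (coord j) (Derive_n g m)).
    + destruct q, j; [apply continuous_fst | apply continuous_snd].
    + apply (ex_derive_continuous (Derive_n g m)). exact (Hg (S m) _).
  - split.
    + intros q. apply (continuous_comp (coord j) (Derive_n g m)).
      * destruct q, j; [apply continuous_fst | apply continuous_snd].
      * apply (ex_derive_continuous (Derive_n g m)). exact (Hg (S m) _).
    + intros i. split.
      * intros [q1 q2]. destruct i, j; simpl; try (exact (Hg (S m) _)); exact (ex_derive_const (K := R_AbsRing) (V := R_NormedModule) _ _).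
      * destruct i, j.
        -- exact (IH (S m)).
        -- replace (partial I1 _) with (fun _ : R * R => 0); [apply Ck_const|].
           apply functional_extensionality. intros q. symmetry.
           exact (Derive_const (Derive_n g m (snd q)) _).
        -- replace (partial I2 _) with (fun _ : R * R => 0); [apply Ck_const|].
           apply functional_extensionality. intros q. symmetry.
           exact (Derive_const (Derive_n g m (fst q)) _).
        -- exact (IH (S m)).
Qed.

End Smooth.

Section SaddleMetric.

Context (g p k : R -> R) (f : R * R -> R)
  (f_def : forall x y, f (x, y) = g x - g y)
  (g_derive : forall t, is_derive g t (p t))
  (p_derive : forall t, is_derive p t (k t)).

Notation h := (induced_metric (graph_param f)).

Lemma height_partial (i : idx) (x y : R) :
  partial i f (x, y) = match i with I1 => p x | I2 => - p y end.
Proof.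
  unfold partial. apply is_derive_unique. destruct i; simpl.
  - apply is_derive_ext with (fun s => g s - g y); [intros; now rewrite f_def|].
    eapply is_derive_eq; [apply is_derive_Rminus; [apply g_derive | apply @is_derive_const]|].
    unfold zero; simpl. ring.
  - apply is_derive_ext with (fun s => g x - g s); [intros; now rewrite f_def|].
    eapply is_derive_eq; [apply is_derive_Rminus; [apply @is_derive_const | apply g_derive]|].
    unfold zero; simpl. ring.
Qed.

Lemma coordinate_partial (i j : idx) (q : R * R) :
  partial i (coord j) q = match i, j with I1, I1 | I2, I2 => 1 | _, _ => 0 end.
Proof. unfold partial. destruct i, j; simpl; first [apply Derive_id | apply Derive_const]. Qed.

Lemma metric_entries (i j : idx) (x y : R) :
  h i j (x, y) = match i, j with
                 | I1, I1 => 1 + p x * p x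
                 | I2, I2 => 1 + p y * p y
                 | _, _ => - (p x * p y)
                 end.
Proof.
  unfold induced_metric.
  change (fun q => fst (fst (graph_param f q))) with (coord I1 : R * R -> R).
  change (fun q => snd (fst (graph_param f q))) with (coord I2 : R * R -> R).
  change (fun q => snd (graph_param f q)) with (fun q => f q).
  change (fun q => f q) with f.
  rewrite !coordinate_partial, !height_partial. destruct i, j; ring.
Qed.

Lemma metric_inner (x y v1 v2 : R) :
  inner h (x, y) (v1, v2) (v1, v2) = v1 * v1 + v2 * v2 + rise p x y v1 v2 * rise p x y v1 v2.
Proof. unfold inner, sum_idx. rewrite !metric_entries. unfold rise; simpl. ring. Qed.

Lemma metric_det_area (x y : R) : metric_det h (x, y) = area_factor p x y.
Proof. unfold metric_det. rewrite !metric_entries. unfold area_factor. ring. Qed.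

(** The diagonal entries of the Hessian of [f]; the mixed ones vanish. *)
Definition hess (i : idx) (x y : R) : R := match i with I1 => k x | I2 => - k y end.
Definition grad (i : idx) (x y : R) : R := match i with I1 => p x | I2 => - p y end.

Lemma metric_partial (l i j : idx) (x y : R) :
  partial l (h i j) (x, y) =
  (match l, i with I1, I1 | I2, I2 => hess l x y | _, _ => 0 end) * grad j x y
  + grad i x y * (match l, j with I1, I1 | I2, I2 => hess l x y | _, _ => 0 end).
Proof.
  unfold partial. apply is_derive_unique.
  set (c := fun i j (a b : R) => match i, j with
                 | I1, I1 => 1 + p a * p a
                 | I2, I2 => 1 + p b * p b
                 | _, _ => - (p a * p b)
                 end).
  assert (E : forall a b, h i j (a, b) = c i j a b) by (intros; apply metric_entries).
  pose proof (p_derive x) as Dx. pose proof (p_derive y) as Dy.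
  assert (Dx' : Derive p x = k x) by now apply is_derive_unique.
  assert (Dy' : Derive p y = k y) by now apply is_derive_unique.
  assert (Ex : is_derive (fun s => c i j s y) x
    ((match i with I1 => k x | _ => 0 end) * grad j x y + grad i x y * (match j with I1 => k x | _ => 0 end))).
  { unfold c, grad. destruct i, j; auto_derive;
    try (repeat split; now exists (k x)); change (Derive (fun x0 : R => p x0) x) with (Derive p x);
    rewrite ?Dx'; ring. }
  assert (Ey : is_derive (fun s => c i j x s) y
    ((match i with I2 => - k y | _ => 0 end) * grad j x y + grad i x y * (match j with I2 => - k y | _ => 0 end))).
  { unfold c, grad. destruct i, j; auto_derive;
    try (repeat split; now exists (k y)); change (Derive (fun x0 : R => p x0) y) with (Derive p y);
    rewrite ?Dy'; ring. }
  destruct l; simpl.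
  - apply is_derive_ext with (2 := Ex). intros; now rewrite E.
  - apply is_derive_ext with (2 := Ey). intros; now rewrite E.
Qed.

(** For the graph of a function, [Gamma^l_ij = f_l f_ij / W]. *)
Lemma christoffel_saddle (l i j : idx) (x y : R) :
  christoffel h l i j (x, y) =
  grad l x y * (match i, j with I1, I1 | I2, I2 => hess i x y | _, _ => 0 end) / area_factor p x y.
Proof.
  pose proof (area_factor_ge1 p x y).
  unfold christoffel, sum_idx. rewrite !metric_partial.
  destruct l, i, j; unfold metric_inv; rewrite !metric_entries, metric_det_area;
  unfold hess, grad, area_factor in *; field; lra.
Qed.

(** The only derivatives needed are those of the symbols [Gamma^l_22] along the first coordinate:
    [Gamma^l_12] vanishes, and [Gamma^l_22] involves [k] only at the second coordinate, so that no
    third derivative of [g] enters. *)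
Lemma saddle_curvature (x y : R) :
  curvature h (x, y) = - (k x * k y) / (area_factor p x y * area_factor p x y).
Proof.
  pose proof (area_factor_ge1 p x y) as HW.
  assert (D12 : forall l, partial I2 (christoffel h l I1 I2) (x, y) = 0).
  { intros l. unfold partial. rewrite (Derive_ext _ (fun _ => 0)); [exact (Derive_const 0 _)|].
    intros t. simpl. rewrite christoffel_saddle. unfold Rdiv. ring. }
  assert (Dx : is_derive (fun s => area_factor p s y) x (2 * p x * k x)).
  { unfold area_factor. eapply is_derive_eq.
    - apply is_derive_Rplus; [apply is_derive_Rplus|].
      + apply @is_derive_const.
      + apply is_derive_Rmult; apply p_derive.
      + apply @is_derive_const.
    - unfold zero; simpl. ring. }
  assert (DI : is_derive (fun s => / area_factor p s y) x
                 (- (2 * p x * k x) / area_factor p x y ^ 2)).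
  { apply (is_derive_inv (fun s => area_factor p s y) x _ Dx). lra. }
  assert (D1 : partial I1 (christoffel h I1 I2 I2) (x, y) =
     - k y * (k x / area_factor p x y - p x * (2 * p x * k x) / area_factor p x y ^ 2)).
  { unfold partial. apply is_derive_unique. simpl.
    apply is_derive_ext with (fun s => - k y * (p s * / area_factor p s y)).
    { intros s. rewrite christoffel_saddle. unfold grad, hess, Rdiv.
      match goal with |- ?l = ?r => change (@eq R l r) end. ring. }
    eapply is_derive_eq.
    - apply is_derive_Rscal, is_derive_Rmult; [apply p_derive | exact DI].
    - simpl. field. lra. }
  assert (D2 : partial I1 (christoffel h I2 I2 I2) (x, y) =
     - (p y * k y * (2 * p x * k x) / area_factor p x y ^ 2)).
  { unfold partial. apply is_derive_unique. simpl.
    apply is_derive_ext with (fun s => p y * k y * / area_factor p s y).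
    { intros s. rewrite christoffel_saddle. unfold grad, hess, Rdiv.
      match goal with |- ?l = ?r => change (@eq R l r) end. ring. }
    eapply is_derive_eq.
    - apply is_derive_Rscal; exact DI.
    - simpl. field. lra. }
  unfold curvature, sum_idx, riemann, sum_idx.
  rewrite !D12, D1, D2, !christoffel_saddle, !metric_entries, metric_det_area.
  unfold grad, hess, area_factor in *. field. lra.
Qed.

Lemma saddle_negatively_curved : (forall t, 0 < k t) -> negatively_curved h.
Proof.
  intros k_pos [x y]. rewrite saddle_curvature.
  pose proof (area_factor_ge1 p x y).
  apply Rdiv_neg_pos; [|nra]. pose proof (k_pos x). pose proof (k_pos y). nra.
Qed.

Lemma geodesic_equation (x y v1 v2 : R) (l : idx) :
  - sum_idx (fun i => sum_idx (fun j =>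
       christoffel h l i j (x, y) * coord i (v1, v2) * coord j (v1, v2)))
  = - grad l x y * bending p k x y v1 v2.
Proof.
  unfold sum_idx. rewrite !christoffel_saddle.
  pose proof (area_factor_ge1 p x y).
  unfold grad, hess, bending; simpl. destruct l; field; lra.
Qed.

Lemma unit_geodesic_saddle (D : R -> Prop) (c : R -> R * R) :
  unit_geodesic h D c ->
  exists u v, forall t, D t -> geodesic_at p k (fun s => fst (c s)) (fun s => snd (c s)) u v t.
Proof.
  intros [V HV]. exists (fun s => fst (V s)), (fun s => snd (V s)).
  intros t Ht. destruct (HV t Ht) as [U E].
  destruct (E I1) as [E1 F1]. destruct (E I2) as [E2 F2]. clear E HV.
  simpl in E1, E2.
  assert (Ec : c t = (fst (c t), snd (c t))) by apply surjective_pairing.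
  assert (EV : V t = (fst (V t), snd (V t))) by apply surjective_pairing.
  rewrite Ec, EV, metric_inner in U.
  rewrite Ec, EV, geodesic_equation in F1, F2.
  constructor; try assumption.
  eapply is_derive_eq; [exact F2|]. unfold grad. ring.
Qed.

Lemma saddle_unit_geodesic (D : R -> Prop) (x y u v : R -> R) :
  (forall t, D t -> geodesic_at p k x y u v t) ->
  unit_geodesic h D (fun t => (x t, y t)).
Proof.
  intros H. exists (fun t => (u t, v t)). intros t Ht.
  destruct (H t Ht) as [Dx Dy Du Dv U]. split.
  - rewrite metric_inner. exact U.
  - intros l. rewrite geodesic_equation. destruct l; simpl; split; try assumption.
    eapply is_derive_eq; [exact Dv|]. unfold grad. ring.
Qed.

Lemma saddle_riemannian : smooth_line g -> riemannian_metric h.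
Proof.
  intros Hg. split; [|split].
  - assert (Ep : p = Derive_n g 1).
    { apply functional_extensionality. intros t. symmetry. now apply is_derive_unique. }
    assert (cx : forall n, Ck n (fun q => p (fst q))) by (intros n; rewrite Ep; exact (Ck_coord n 1 g I1 Hg)).
    assert (cy : forall n, Ck n (fun q => p (snd q))) by (intros n; rewrite Ep; exact (Ck_coord n 1 g I2 Hg)).
    intros i j n.
    replace (h i j) with (fun q : R * R => match i, j with
                 | I1, I1 => 1 + p (fst q) * p (fst q)
                 | I2, I2 => 1 + p (snd q) * p (snd q)
                 | _, _ => - (1) * (p (fst q) * p (snd q))
                 end).
    2:{ apply functional_extensionality. intros [x y]. rewrite metric_entries.
        destruct i, j; simpl; ring. }
    destruct i, j.
    + apply Ck_plus; [apply Ck_const | now apply Ck_mult].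
    + apply Ck_mult; [apply Ck_const | now apply Ck_mult].
    + apply Ck_mult; [apply Ck_const | now apply Ck_mult].
    + apply Ck_plus; [apply Ck_const | now apply Ck_mult].
  - intros i j [x y]. rewrite !metric_entries. destruct i, j; reflexivity.
  - intros [x y] [v1 v2] Hv. rewrite metric_inner.
    pose proof (Rle_0_sqr (rise p x y v1 v2)). unfold Rsqr in *.
    destruct (Req_dec v1 0) as [E1|N1].
    + assert (v2 <> 0) by (intros E2; apply Hv; now rewrite E1, E2). nra.
    + nra.
Qed.

End SaddleMetric.

(** * Distance and completeness *)

Section Distance.

Context (g p k : R -> R) (f : R * R -> R) (G : R)
  (f_def : forall x y, f (x, y) = g x - g y)
  (g_derive : forall t, is_derive g t (p t))
  (p_derive : forall t, is_derive p t (k t))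
  (p_bound : forall t, Rabs (p t) <= G).

Notation h := (induced_metric (graph_param f)).

Lemma G_nonneg : 0 <= G.
Proof. apply Rle_trans with (2 := p_bound 0). apply Rabs_pos. Qed.

Lemma speed_saddle (c v : R -> R * R) (t : R) :
  speed h c v t = sqrt (fst (v t) * fst (v t) + snd (v t) * snd (v t)
    + rise p (fst (c t)) (snd (c t)) (fst (v t)) (snd (v t))
      * rise p (fst (c t)) (snd (c t)) (fst (v t)) (snd (v t))).
Proof.
  unfold speed. rewrite <- (metric_inner g p f f_def g_derive).
  now rewrite <- !surjective_pairing.
Qed.

Lemma speed_continuous (c v : R -> R * R) (t : R) :
  C1_curve c v -> 0 <= t <= 1 -> continuous (speed h c v) t.
Proof.
  intros Hc Ht.
  destruct (Hc t Ht I1) as [d1 c1]. destruct (Hc t Ht I2) as [d2 c2]. simpl in *.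
  apply is_derive_continuous in d1, d2.
  assert (cp : forall s, continuous p s) by (intros s; eapply is_derive_continuous, p_derive).
  assert (mul : forall f h, continuous f t -> continuous h t -> continuous (fun s : R => f s * h s : R) t)
    by (intros f1 f2; apply (continuous_mult f1 f2)).
  assert (pls : forall f h, continuous f t -> continuous h t -> continuous (fun s : R => f s + h s : R) t)
    by (intros f1 f2; apply (continuous_plus f1 f2)).
  assert (cr : continuous (fun s => rise p (fst (c s)) (snd (c s)) (fst (v s)) (snd (v s))) t).
  { apply (continuous_minus (fun s => p (fst (c s)) * fst (v s)) (fun s => p (snd (c s)) * snd (v s)));
    apply mul; try assumption.
    - now apply (continuous_comp (fun s => fst (c s)) p).
    - now apply (continuous_comp (fun s => snd (c s)) p). }
  apply (continuous_ext (fun t => sqrt (fst (v t) * fst (v t) + snd (v t) * snd (v t)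
    + rise p (fst (c t)) (snd (c t)) (fst (v t)) (snd (v t))
      * rise p (fst (c t)) (snd (c t)) (fst (v t)) (snd (v t))))).
  { intros s. symmetry. apply speed_saddle. }
  apply (continuous_comp (fun t => fst (v t) * fst (v t) + snd (v t) * snd (v t)
    + rise p (fst (c t)) (snd (c t)) (fst (v t)) (snd (v t))
      * rise p (fst (c t)) (snd (c t)) (fst (v t)) (snd (v t))) sqrt).
  - apply pls; [apply pls|]; now apply mul.
  - apply continuous_sqrt.
Qed.

Lemma coord_le_speed (c v : R -> R * R) (i : idx) (t : R) :
  Rabs (coord i (v t)) <= speed h c v t.
Proof.
  rewrite speed_saddle, <- sqrt_Rsqr_abs. apply sqrt_le_1_alt. unfold Rsqr.
  pose proof (Rle_0_sqr (rise p (fst (c t)) (snd (c t)) (fst (v t)) (snd (v t)))) as H.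
  unfold Rsqr in H.
  pose proof (Rle_0_sqr (fst (v t))). pose proof (Rle_0_sqr (snd (v t))). unfold Rsqr in *.
  destruct i; simpl; lra.
Qed.

Lemma path_length_ge_coord (q q' : R * R) (l : R) (i : idx) :
  path_length h q q' l -> Rabs (coord i q' - coord i q) <= l.
Proof.
  induction 1 as [q | c v q l Hc _ IH].
  - rewrite Rminus_diag, Rabs_R0. lra.
  - replace (coord i q - coord i (c 0)) with
      ((coord i (c 1) - coord i (c 0)) + (coord i q - coord i (c 1))) by ring.
    refine (Rle_trans _ _ _ (Rabs_triang _ _) _). apply Rplus_le_compat; [|exact IH].
    apply (norm_RInt_le (fun s => coord i (v s)) (speed h c v) 0 1); [lra| | |].
    + intros t _. apply coord_le_speed.
    + apply (is_RInt_derive (fun s => coord i (c s)) (fun s => coord i (v s)));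
      rewrite Rmin_left, Rmax_right by lra; intros t Ht; now apply Hc.
    + apply @RInt_correct, @ex_RInt_continuous. rewrite Rmin_left, Rmax_right by lra.
      intros t Ht. now apply speed_continuous.
Qed.

Definition taxicab (q q' : R * R) : R := Rabs (fst q' - fst q) + Rabs (snd q' - snd q).

Lemma short_path (q q' : R * R) :
  exists l, path_length h q q' l /\ l <= (1 + G) * taxicab q q'.
Proof.
  set (d1 := fst q' - fst q). set (d2 := snd q' - snd q).
  set (c := fun t => (fst q + t * d1, snd q + t * d2)).
  set (v := fun _ : R => (d1, d2)).
  assert (Hc : C1_curve c v).
  { intros t _ i. split.
    - destruct i; simpl; auto_derive; trivial; ring.
    - destruct i; apply continuous_const. }
  exists (RInt (speed h c v) 0 1 + 0). split.
  - replace q with (c 0) at 1 by (unfold c; destruct q; simpl; f_equal; ring).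
    apply path_cons; [exact Hc|].
    replace (c 1) with q' by (unfold c, d1, d2; destruct q'; simpl; f_equal; ring).
    constructor.
  - rewrite Rplus_0_r.
    assert (X : ex_RInt (speed h c v) 0 1).
    { apply @ex_RInt_continuous. rewrite Rmin_left, Rmax_right by lra.
      intros t Ht. now apply speed_continuous. }
    refine (Rle_trans _ _ _ (Rle_abs _) _).
    replace ((1 + G) * taxicab q q') with ((1 - 0) * ((1 + G) * taxicab q q')) by ring.
    apply abs_RInt_le_const; [lra | exact X |].
    intros t _. pose proof G_nonneg as G0.
    pose proof (Rabs_pos d1). pose proof (Rabs_pos d2).
    assert (HT : 0 <= (1 + G) * taxicab q q').
    { unfold taxicab. fold d1 d2. apply Rmult_le_pos; lra. }
    rewrite speed_saddle, Rabs_pos_eq by apply sqrt_pos.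
    rewrite <- (sqrt_Rsqr ((1 + G) * taxicab q q')) by exact HT.
    apply sqrt_le_1_alt. unfold v; simpl.
    set (r := rise p _ _ d1 d2).
    assert (Hr : Rabs r <= G * taxicab q q').
    { unfold r, rise, Rminus. refine (Rle_trans _ _ _ (Rabs_triang _ _) _).
      rewrite Rabs_Ropp, 2 Rabs_mult. unfold taxicab. fold d1 d2.
      rewrite Rmult_plus_distr_l.
      apply Rplus_le_compat; apply Rmult_le_compat_r; auto using Rabs_pos. }
    assert (r * r <= (G * taxicab q q') * (G * taxicab q q')).
    { replace (r * r) with (Rabs r * Rabs r) by (rewrite <- Rabs_mult; apply Rabs_pos_eq; nra).
      apply Rmult_le_compat; auto using Rabs_pos. }
    assert (d1 * d1 + d2 * d2 <= taxicab q q' * taxicab q q').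
    { unfold taxicab. fold d1 d2.
      replace (d1 * d1) with (Rabs d1 * Rabs d1) by (rewrite <- Rabs_mult; apply Rabs_pos_eq; nra).
      replace (d2 * d2) with (Rabs d2 * Rabs d2) by (rewrite <- Rabs_mult; apply Rabs_pos_eq; nra).
      nra. }
    unfold Rsqr.
    assert (0 <= taxicab q q') by (unfold taxicab; fold d1 d2; lra).
    assert (0 <= G * (taxicab q q' * taxicab q q')) by (apply Rmult_le_pos; nra).
    lra.
Qed.

(** The distance is equivalent to that of the coordinate plane, from which completeness is
    inherited.  Both inequalities are needed for the infimum to be a real number. *)
Lemma riem_dist_bounds (q q' : R * R) (i : idx) :
  Rabs (coord i q' - coord i q) <= riem_dist h q q' <= (1 + G) * taxicab q q'.
Proof.
  destruct (short_path q q') as [l [Hl Hb]].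
  unfold riem_dist. destruct (Glb_Rbar_correct (path_length h q q')) as [lb glb].
  assert (L : Rbar_le (Rabs (coord i q' - coord i q)) (Glb_Rbar (path_length h q q'))).
  { apply glb. intros m Hm. now apply path_length_ge_coord. }
  specialize (lb l Hl).
  destruct (Glb_Rbar (path_length h q q')) as [m| |]; simpl in *; try contradiction.
  split; [exact L | lra].
Qed.

Lemma riem_dist_refl (q : R * R) : riem_dist h q q = 0.
Proof.
  pose proof (riem_dist_bounds q q I1) as [H1 H2].
  unfold taxicab in H2. rewrite !Rminus_diag, Rabs_R0 in *. lra.
Qed.

Lemma saddle_complete : complete h.
Proof.
  intros s Hs.
  assert (cv : forall i, ex_finite_lim_seq (fun n => coord i (s n))).
  { intros i. apply ex_lim_seq_cauchy_corr. intros eps.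
    destruct (Hs eps (cond_pos eps)) as [N HN]. exists N. intros n m Hn Hm.
    rewrite Rabs_minus_sym.
    apply Rle_lt_trans with (2 := HN n m Hn Hm). apply riem_dist_bounds. }
  destruct (cv I1) as [l1 H1]. destruct (cv I2) as [l2 H2]. simpl in H1, H2.
  exists (l1, l2).
  apply is_lim_seq_le_le with (u := fun _ => 0) (w := fun n => (1 + G) * (Rabs (l1 - fst (s n)) + Rabs (l2 - snd (s n)))).
  - intros n. destruct (riem_dist_bounds (s n) (l1, l2) I1) as [B1 B2]. split.
    + apply Rle_trans with (2 := B1). apply Rabs_pos.
    + exact B2.
  - apply is_lim_seq_const.
  - assert (Z : forall (w : nat -> R) l, is_lim_seq w (Finite l) -> is_lim_seq (fun n => Rabs (l - w n)) 0).
    { intros z l Hz. apply (proj1 (is_lim_seq_abs_0 (fun n => l - z n))).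
      replace (Finite 0) with (Finite (l - l)) by (f_equal; ring).
      apply is_lim_seq_minus'; [apply is_lim_seq_const | exact Hz]. }
    replace (Finite 0) with (Rbar_mult (1 + G) (0 + 0)) by (simpl; f_equal; ring).
    apply is_lim_seq_scal_l. apply is_lim_seq_plus'; now apply Z.
Qed.

End Distance.

(** * Failure of visibility *)

Section Ends.

Context (h : metric).

(** The point at infinity of the ray [r]. *)
Definition class_at_infinity (r s : R -> R * R) : Prop := geodesic_ray h s /\ asymptotic h r s.

Lemma visibility_line (r r' : R -> R * R) :
  (forall q, riem_dist h q q = 0) ->
  visibility_axiom h -> geodesic_ray h r -> geodesic_ray h r' -> ~ asymptotic h r r' ->
  exists c, geodesic_line h c /\ asymptotic h r (fun t => c (- t)) /\ asymptotic h r' c.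
Proof.
  intros refl vis Hr Hr' Hn.
  destruct (vis (class_at_infinity r) (class_at_infinity r')) as [c [Hc [[_ H1] [_ H2]]]].
  - exists r. split; [exact Hr | intros s; apply iff_refl].
  - exists r'. split; [exact Hr' | intros s; apply iff_refl].
  - intros E. apply Hn. apply (f_equal (fun xi => xi r')) in E.
    assert (H : class_at_infinity r' r').
    { split; [exact Hr'|]. exists 0. intros t _. rewrite refl. lra. }
    rewrite <- E in H. apply H.
  - now exists c.
Qed.

End Ends.

Section NoVisibility.

Context (g p k dk : R -> R) (f : R * R -> R) (a b G : R)
  (f_def : forall x y, f (x, y) = g x - g y)
  (g_derive : forall t, is_derive g t (p t))
  (p_derive : forall t, is_derive p t (k t))
  (k_derive : forall t, is_derive k t (dk t))
  (dk_continuous : forall t, continuous dk t)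
  (k_pos : forall t, 0 < k t)
  (p_bounds : forall t, a <= p t <= b)
  (p_bound : forall t, Rabs (p t) <= G)
  (small : b - a = PI / 10).

Notation h := (induced_metric (graph_param f)).

Definition inv_sqrt2 : R := / sqrt 2.

Lemma inv_sqrt2_sqr : inv_sqrt2 * inv_sqrt2 = / 2.
Proof. unfold inv_sqrt2. rewrite <- Rinv_mult, sqrt_sqrt by lra. reflexivity. Qed.

(** The ray from the origin along the half of the diagonal of sign [e]. *)
Definition diagonal (e t : R) : R * R := (e * (inv_sqrt2 * t), e * (inv_sqrt2 * t)).

Lemma diagonal_ray (e : R) : e * e = 1 -> geodesic_ray h (diagonal e).
Proof.
  intros He.
  apply (saddle_unit_geodesic g p k f f_def g_derive p_derive _ _ _ (fun _ => e * inv_sqrt2) (fun _ => e * inv_sqrt2)).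
  intros t _. pose proof inv_sqrt2_sqr as Hh.
  assert (B0 : bending p k (e * (inv_sqrt2 * t)) (e * (inv_sqrt2 * t)) (e * inv_sqrt2) (e * inv_sqrt2) = 0).
  { unfold bending, Rdiv. rewrite Rminus_diag. ring. }
  assert (D : is_derive (fun t => e * (inv_sqrt2 * t)) t (e * inv_sqrt2)).
  { auto_derive; trivial. ring. }
  constructor; try exact D.
  - eapply is_derive_eq; [apply @is_derive_const|]. rewrite B0. unfold zero; simpl. ring.
  - eapply is_derive_eq; [apply @is_derive_const|]. rewrite B0. unfold zero; simpl. ring.
  - unfold rise. rewrite Rminus_diag.
    replace (e * inv_sqrt2 * (e * inv_sqrt2)) with ((e * e) * (inv_sqrt2 * inv_sqrt2)) by ring.
    rewrite He, Hh. lra.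
Qed.

Lemma asymptotic_coord (r s : R -> R * R) : asymptotic h r s ->
  exists D, 0 <= D /\ forall t, 0 <= t ->
    Rabs (fst (s t) - fst (r t)) <= D /\ Rabs (snd (s t) - snd (r t)) <= D.
Proof.
  intros [D HD].
  assert (H : forall t, 0 <= t -> forall i, Rabs (coord i (s t) - coord i (r t)) <= D).
  { intros t Ht i. apply Rle_trans with (2 := HD t Ht).
    apply (riem_dist_bounds g p k f G f_def g_derive p_derive p_bound). }
  exists D. split.
  - apply Rle_trans with (2 := H 0 (Rle_refl 0) I1). apply Rabs_pos.
  - intros t Ht. split; [apply (H t Ht I1) | apply (H t Ht I2)].
Qed.

Lemma g_lipschitz (s t : R) : Rabs (g s - g t) <= G * Rabs (s - t).
Proof.
  destruct (MVT_gen g t s p) as [c [_ E]].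
  - intros; apply g_derive.
  - intros r _. eapply continuous_continuity_pt, is_derive_continuous, g_derive.
  - rewrite E, Rabs_mult. apply Rmult_le_compat_r; [apply Rabs_pos | apply p_bound].
Qed.

Lemma k_continuous (t : R) : continuous k t.
Proof. eapply is_derive_continuous, k_derive. Qed.

Notation delta := (turning_constant a b).

Lemma delta_pos : 0 < delta.
Proof. now apply turning_constant_pos. Qed.

(** The geodesic ray from the origin orthogonal to the diagonal: the tangent of the diagonal is
    proportional to [(1, 1, 0)], so orthogonality means [v 0 = - u 0]. *)
Section Transversal.

Context (x y u v : R -> R)
  (geo : forall t, 0 <= t -> geodesic_at p k x y u v t)
  (x_init : x 0 = 0) (y_init : y 0 = 0) (transverse : v 0 = - u 0).

(** Near the diagonal both [x - y] and the height are bounded, and so is the component of the ray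
    along its initial direction; but this component grows at rate [delta]. *)
Lemma transversal_not_diagonal (e : R) : ~ asymptotic h (diagonal e) (fun t => (x t, y t)).
Proof.
  intros As. destruct (asymptotic_coord _ _ As) as [D [D0 HD]]. simpl in HD.
  pose proof delta_pos as Hd.
  pose (z := height g x y).
  assert (delta <= 0); [|lra].
  apply coefficient_nonpos with (Rabs (u 0) * (2 * D) + Rabs (rise_along p x y u v 0) * (G * (2 * D))).
  intros t Ht. destruct (HD t Ht) as [Hx Hy].
  assert (Hxy : Rabs (x t - y t) <= 2 * D).
  { replace (x t - y t) with ((x t - e * (inv_sqrt2 * t)) + - (y t - e * (inv_sqrt2 * t))) by ring.
    refine (Rle_trans _ _ _ (Rabs_triang _ _) _). rewrite Rabs_Ropp. lra. }
  assert (Hz : Rabs (z t) <= G * (2 * D)).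
  { apply (height_le g G g_lipschitz (G_nonneg p G p_bound)). exact Hxy. }
  assert (Z0 : z 0 = 0) by (unfold z, height; rewrite x_init, y_init; ring).
  pose proof (tangent_chord g p k a b g_derive p_derive k_continuous k_pos p_bounds x y u v
                0 0 t (Rle_refl 0) Ht) as T.
  specialize (T ltac:(intros r Hr; apply geo; lra)).
  fold z in T. rewrite Z0, x_init, y_init, transverse, !Rminus_0_r in T.
  replace (u 0 * x t + - u 0 * y t) with (u 0 * (x t - y t)) in T by ring.
  rewrite (Rmult_comm t). apply Rle_trans with (1 := T).
  apply Rplus_le_compat; (refine (Rle_trans _ _ _ (Rle_abs _) _); rewrite Rabs_mult;
    apply Rmult_le_compat_l; [apply Rabs_pos | assumption]).
Qed.

(** The line joining the end of sign [e] of the diagonal to the end of the transversal ray recedes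
    from the former, and the ray stays at bounded distance from the line. *)
Lemma pushed_away_from_diagonal_end (e : R) : e * e = 1 -> visibility_axiom h ->
  exists M, forall t, 0 <= t -> delta * t + e * inv_sqrt2 * (x t + y t) <= M.
Proof.
  intros He vis.
  destruct (visibility_line h (diagonal e) (fun t => (x t, y t))) as [c [line [back forth]]].
  - apply (riem_dist_refl g p k f G f_def g_derive p_derive p_bound).
  - exact vis.
  - now apply diagonal_ray.
  - now apply (saddle_unit_geodesic g p k f f_def g_derive p_derive _ x y u v).
  - apply transversal_not_diagonal.
  - destruct (unit_geodesic_saddle g p k f f_def g_derive p_derive _ c line) as [cu [cv geoc]].
    destruct (asymptotic_coord _ _ back) as [D [_ HD]]. simpl in HD.
    destruct (asymptotic_coord _ _ forth) as [D' [_ HD']]. simpl in HD'.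
    assert (near : forall S, 0 <= S -> Rabs (fst (c (- S)) - e * (inv_sqrt2 * S)) <= D
                                  /\ Rabs (snd (c (- S)) - e * (inv_sqrt2 * S)) <= D).
    { intros S HS. now apply HD. }
    pose proof (line_from_diagonal_end g p k a b G g_derive p_derive k_continuous k_pos p_bounds
      g_lipschitz (G_nonneg p G p_bound) (fun t => fst (c t)) (fun t => snd (c t)) cu cv e inv_sqrt2 D
      (fun r => geoc r I) near) as L.
    exists (e * inv_sqrt2 * (fst (c 0) + snd (c 0)) + Rabs (e * inv_sqrt2) * (D' + D')).
    intros t Ht. specialize (L t Ht). destruct (HD' t Ht) as [Hx Hy].
    assert (P : e * inv_sqrt2 * ((x t - fst (c t)) + (y t - snd (c t))) <= Rabs (e * inv_sqrt2) * (D' + D')).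
    { refine (Rle_trans _ _ _ (Rle_abs _) _). rewrite Rabs_mult.
      apply Rmult_le_compat_l; [apply Rabs_pos|].
      refine (Rle_trans _ _ _ (Rabs_triang _ _) _).
      rewrite (Rabs_minus_sym (x t)), (Rabs_minus_sym (y t)). lra. }
    lra.
Qed.

Lemma transversal_blocks_visibility : ~ visibility_axiom h.
Proof.
  intros vis.
  destruct (pushed_away_from_diagonal_end 1 ltac:(ring) vis) as [M1 H1].
  destruct (pushed_away_from_diagonal_end (-1) ltac:(ring) vis) as [M2 H2].
  pose proof delta_pos.
  assert (delta <= 0); [|lra].
  apply coefficient_nonpos with ((M1 + M2) / 2). intros t Ht.
  specialize (H1 t Ht). specialize (H2 t Ht). lra.
Qed.

End Transversal.

Theorem saddle_not_visible : ~ visibility_axiom h.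
Proof.
  set (n := sqrt (2 + 4 * (p 0 * p 0))).
  assert (Hn2 : n * n = 2 + 4 * (p 0 * p 0)) by (apply sqrt_sqrt; nra).
  assert (Hn : 0 < n) by (apply sqrt_lt_R0; nra).
  destruct (unit_geodesic_exists p k dk p_derive k_derive dk_continuous 0 0 (/ n) (- / n))
    as [x [y [u [v [X0 [Y0 [U0 [V0 geo]]]]]]]].
  - unfold rise. field_simplify; [|lra].
    replace (n ^ 2) with (n * n) by ring. rewrite Hn2. field. nra.
  - apply (transversal_blocks_visibility x y u v geo X0 Y0). now rewrite V0, U0.
Qed.

End NoVisibility.

Theorem theorem24 (g : R -> R) (f : R * R -> R) (a b : R)
  (g_smooth : smooth_line g)
  (g_convex : forall t : R, 0 < Derive_n g 2 t)
  (g_lim_p : is_lim (Derive g) p_infty b)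
  (g_lim_m : is_lim (Derive g) m_infty a)
  (g_total : b - a = PI / 10)
  (f_def : forall x y : R, f (x, y) = g x - g y) :
  riemannian_metric (induced_metric (graph_param f)) /\
  complete (induced_metric (graph_param f)) /\
  negatively_curved (induced_metric (graph_param f)) /\
  ~ visibility_axiom (induced_metric (graph_param f)).
Proof.
  assert (D1 : forall t, is_derive g t (Derive g t)).
  { intros t. apply Derive_correct. exact (g_smooth 1%nat t). }
  assert (D2 : forall t, is_derive (Derive g) t (Derive_n g 2 t)).
  { intros t. apply (Derive_correct (Derive g)). exact (g_smooth 2%nat t). }
  assert (D3 : forall t, is_derive (Derive_n g 2) t (Derive_n g 3 t)).
  { intros t. apply (Derive_correct (Derive_n g 2)). exact (g_smooth 3%nat t). }
  assert (C3 : forall t, continuous (Derive_n g 3) t).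
  { intros t. apply (ex_derive_continuous (Derive_n g 3)). exact (g_smooth 4%nat t). }
  pose proof (increasing_limits_bound _ _ a b D2 g_convex g_lim_p g_lim_m) as slope.
  assert (bound : forall t, Rabs (Derive g t) <= Rabs a + Rabs b).
  { intros t. pose proof (slope t). pose proof (Rle_abs b). pose proof (Rle_abs (- a)).
    rewrite Rabs_Ropp in *. pose proof (Rabs_pos a). pose proof (Rabs_pos b).
    apply Rabs_le. lra. }
  split; [|split; [|split]].
  - exact (saddle_riemannian g _ f f_def D1 g_smooth).
  - exact (saddle_complete g _ _ f _ f_def D1 D2 bound).
  - exact (saddle_negatively_curved g _ _ f f_def D1 D2 g_convex).
  - exact (saddle_not_visible g _ _ _ f a b _ f_def D1 D2 D3 C3 g_convex slope bound g_total).
Qed.
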